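(* Let $p\ge1$, $n,d,K\in\mathbb{N}$, $\Omega\subseteq\mathbb{R}^d$ compact, and consider graphs in $G_{\le n}(\Omega)$ with node set contained in $\{1,\dots,n\}$. Thin-SortMPNN of depth $K$ is defined by $x_v^{(0)}=x_v$ and for $k=1,\dots,K$: $$c_v^{(k)}=\mathrm{sort}\big(a^{(k)}\cdot x^{(k-1)}_{v,\bullet}\big)\in\mathbb{R}^n,\qquad x_v^{(k)}=d^{(k)}\cdot\mathrm{concat}(x_v^{(k-1)},c_v^{(k)})\in\mathbb{R},$$ with readout $c^{\mathrm{global}}=b^{(K+1)}\cdot\mathrm{sort}\big(a^{(K+1)}\cdot x^{(K)}_{\bullet}\big)$, where $x^{(k-1)}_{v,\bullet}=(x^{(k-1)}_{v,1},\dots,x^{(k-1)}_{v,n})$ with $x^{(k-1)}_{v,s}=x^{(k-1)}_s$ if $(v,s)\in E$ and $x^{(k-1)}_{v,s}=z_{k-1}$ otherwise; $x^{(K)}_\bullet=(x^{(K)}_1,\dots,x^{(K)}_n)$ with $x^{(K)}_s=z_K$ if $s\notin V$; $a\cdot(y_1,\dots,y_n)=(a\cdot y_1,\dots,a\cdot y_n)$; and $\mathrm{sort}$ sorts nondecreasingly. All parameters $a^{(k)},b^{(K+1)},d^{(k)}$ are independent and uniform on the unit spheres of the appropriate dimensions. Let $\Omega_k$ be the (compact) set of all attainable values $x_v^{(k)}$ over graphs, nodes and parameters, and assume $z_k\notin\Omega_k$ for $k=0,\dots,K$ ($\Omega_0=\Omega$). Then there exist $c_1,c_2>0$ such that: (1)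 for each $0\le k\le K$ and all nodes $u,v$ of graphs in $G_{\le n}(\Omega)$, $\mathbb{E}\big[\|x_v^{(k)}-x_u^{(k)}\|_p^p\big]\ge c_1\,TD^p(T_v^{(k)},T_u^{(k)})$; (2) for all $G,\hat G\in G_{\le n}(\Omega)$, $\mathbb{E}\big[|c^{\mathrm{global}}-\hat c^{\mathrm{global}}|^p\big]\ge c_2\,TMD^{(K)}(G,\hat G)^p$, where the expectations are over all parameters.
   Context: $G_{\le n}(\Omega)$ is the set of graphs $G=(V,E,X)$ with $|V|\le n$ and node features in $\Omega$. Fix $z\in\mathbb{R}^d\setminus\Omega$ for the tree distances. Computation trees: $T_v^{(0)}$ is a single root node with feature $x_v$; $T_v^{(k)}$ is obtained from $T_v^{(k-1)}$ by attaching to each leaf (corresponding to graph node $u$) children corresponding to the neighbors of $u$, each with its feature. The blank tree $\bar T_z$ is a single node with feature $z$. For a rooted tree $T$ with root $r$, $\mathcal T_r$ is the multiset of subtrees rooted at the children of $r$. For multisets of trees $A,B$ of size at most $n$, $W^{(\bar T_z)}_{TD,1}(A,B)=\min_{\tau\in S_n}\sum_{j=1}^n TD(A'_j,B'_{\tau(j)})$ with $A',B'$ padded by copies of $\bar T_z$ to $n$ elements. $TD(T_a,T_b)=\|x_a-x_b\|_p+W^{(\bar T_z)}_{TD,1}(\mathcal T_a,\mathcal T_b)$ if the maximal depth of $T_a,T_b$ is positive and $\|x_a-x_b\|_p$ otherwise ($x_a,x_b$ root features). $TMD^{(K)}(G,H)=W^{(\bar T_z)}_{TD,1}(\{\!\!\{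 T_v^{(K)}:v\in V_G\}\!\!\},\{\!\!\{ T_u^{(K)}:u\in V_H\}\!\!\})$. *)

(* Defs.v *)
From HB Require Import structures.
From mathcomp Require Import all_boot all_order all_algebra all_fingroup.
From mathcomp Require Import all_classical all_reals all_analysis.

Set Implicit Arguments.
Unset Strict Implicit.
Unset Printing Implicit Defensive.

Import Order.TTheory GRing.Theory Num.Theory.
Import numFieldNormedType.Exports.
Local Open Scope ring_scope.

Record graph (R : Type) (d n : nat) := Graph {
  gV : {set 'I_n};
  gE : rel 'I_n;
  gX : 'I_n -> 'rV[R]_d }.

Definition valid_graph (R : Type) (d n : nat) (Omega : set 'rV[R]_d)
  (G : graph R d n) : Prop :=
  [/\ (forall v s, gE G v s -> (v \in gV G) /\ (s \in gV G)),
      (forall v s, gE G v s = gE G s v),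
      (forall v, ~~ gE G v v) &
      (forall v, v \in gV G -> Omega (gX G v))].

Inductive tree (T : Type) := Node of T & seq (tree T).

Definition root_feat (T : Type) (t : tree T) : T := let: Node x _ := t in x.
Definition children (T : Type) (t : tree T) : seq (tree T) :=
  let: Node _ cs := t in cs.

Fixpoint depth (T : Type) (t : tree T) : nat :=
  let: Node _ cs := t in
  if cs is [::] then 0%N else (foldr maxn 0%N (map (@depth T) cs)).+1.

Fixpoint comp_tree (R : Type) (d n : nat) (G : graph R d n) (k : nat)
  (v : 'I_n) : tree 'rV[R]_d :=
  match k with
  | 0 => Node (gX G v) [::]
  | k'.+1 => Node (gX G v)
      [seq comp_tree G k' s | s <- enum 'I_n & gE G v s]
  end.

Section TreeDist.
Variables (R : realType) (p : R) (d n : nat) (zt : 'rV[R]_d).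

Definition pnorm_rV (x : 'rV[R]_d) : R :=
  powR (\sum_(i < d) powR `|x ord0 i| p) p^-1.

Definition blank_tree : tree 'rV[R]_d := Node zt [::].

Definition pad (A : seq (tree 'rV[R]_d)) : seq (tree 'rV[R]_d) :=
  A ++ nseq (n - size A) blank_tree.

Definition Wdist (dist : tree 'rV[R]_d -> tree 'rV[R]_d -> R)
  (A B : seq (tree 'rV[R]_d)) : R :=
  let S := fun s : 'S_n =>
    \sum_(j < n) dist (nth blank_tree (pad A) j) (nth blank_tree (pad B) (s j)) in
  \big[Order.min/S 1%g]_(s : 'S_n) S s.

(* TD computed with fuel k; it coincides with TD once k >= max depth *)
Fixpoint TDf (k : nat) (a b : tree 'rV[R]_d) : R :=
  let nr := pnorm_rV (root_feat a - root_feat b) in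
  match k with
  | 0 => nr
  | k'.+1 =>
    if nilp (children a) && nilp (children b) then nr
    else nr + Wdist (TDf k') (children a) (children b)
  end.

Definition TD (a b : tree 'rV[R]_d) : R := TDf (maxn (depth a) (depth b)) a b.

Definition TMD (K : nat) (G H : graph R d n) : R :=
  Wdist TD [seq comp_tree G K v | v <- enum (gV G)]
           [seq comp_tree H K v | v <- enum (gV H)].

End TreeDist.

(* Thin-SortMPNN. Vectors of R^m are encoded as nat -> R (only the     *)
(* first m coordinates are used).                                      *)
Section MPNN.
Variables (R : realType) (d n : nat).

Definition emb (x : 'rV[R]_d) : nat -> R :=
  fun i => if insub i is Some j then x ord0 j else 0.

Definition scal (r : R) : nat -> R := fun i => if i == 0%N then r else 0.

Definition dot (m : nat) (a y : nat -> R) : R := \sum_(i < m) a i * y i.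

Definition concat (m : nat) (x : nat -> R) (c : seq R) : nat -> R :=
  fun i => if (i < m)%N then x i else nth 0 c (i - m).

Definition dimx (k : nat) : nat := if k is 0 then d else 1%N.

Definition zfam (z0 : 'rV[R]_d) (zs : nat -> R) (k : nat) : nat -> R :=
  if k is 0 then emb z0 else scal (zs k).

(* Parameter list, in order:
   [a^(1); d^(1); a^(2); d^(2); ...; a^(K); d^(K); a^(K+1); b^(K+1)] *)
Definition pdims (K : nat) : seq nat :=
  flatten [seq [:: dimx k; (dimx k + n)%N] | k <- iota 0 K] ++ [:: dimx K; n].

Definition on_sphere (m : nat) (w : nat -> R) : Prop :=
  \sum_(i < m) w i ^+ 2 = 1.

Definition valid_params (K : nat) (ws : seq (nat -> R)) : Prop :=
  size ws = size (pdims K) /\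
  forall i, (i < size ws)%N ->
    on_sphere (nth 0%N (pdims K) i) (nth (fun _ => 0) ws i).

Definition par (ws : seq (nat -> R)) (i : nat) : nat -> R :=
  nth (fun _ => 0) ws i.

Fixpoint layer (G : graph R d n) (ws : seq (nat -> R)) (z : nat -> nat -> R)
  (k : nat) : 'I_n -> nat -> R :=
  match k with
  | 0 => fun v => emb (gX G v)
  | k'.+1 => fun v =>
    let m := dimx k' in
    let a := par ws (2 * k') in
    let dd := par ws (2 * k').+1 in
    let nb := fun s => if gE G v s then layer G ws z k' s else z k' in
    let c := sort <=%R [seq dot m a (nb s) | s <- enum 'I_n] in
    scal (dot (m + n) dd (concat m (layer G ws z k' v) c))
  end.

Definition readout (G : graph R d n) (ws : seq (nat -> R)) (z : nat -> nat -> R)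
  (K : nat) : R :=
  let m := dimx K in
  let a := par ws (2 * K) in
  let b := par ws (2 * K).+1 in
  let xs := fun s => if s \in gV G then layer G ws z K s else z K in
  let c := sort <=%R [seq dot m a (xs s) | s <- enum 'I_n] in
  dot n b (fun j => nth 0 c j).

Definition pnorm (p : R) (m : nat) (x : nat -> R) : R :=
  powR (\sum_(i < m) powR `|x i| p) p^-1.

(* attainable values Omega_k of x_v^{(k)} (k >= 1, scalar features) *)
Definition Omega_k (Omega : set 'rV[R]_d) (z : nat -> nat -> R) (K k : nat)
  : set R :=
  [set r | exists G : graph R d n, valid_graph Omega G /\
     exists v, v \in gV G /\
     exists ws, valid_params K ws /\ layer G ws z k v 0%N = r].

End MPNN.

(* Uniform distribution on the unit sphere S^{m-1} of R^m, defined as  *)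
(* the cone measure: E[g] = (int_{B^m} g(x/|x|) dx) / vol(B^m), where  *)
(* the Lebesgue integral over R^m is the iterated 1-d Lebesgue integral *)
(* (Tonelli; all integrands here are nonnegative).                     *)
Section Sphere.
Variable R : realType.
Local Open Scope ereal_scope.

Definition upd (x : nat -> R) (i : nat) (t : R) : nat -> R :=
  fun j => if j == i then t else x j.

Fixpoint iterint (m : nat) (F : (nat -> R) -> \bar R) : \bar R :=
  match m with
  | 0 => F (fun _ => 0%R)
  | m'.+1 => \int[@lebesgue_measure R]_(t in setT)
               iterint m' (fun x => F (upd x m' t))
  end.

Definition sqnorm (m : nat) (x : nat -> R) : R := (\sum_(i < m) x i ^+ 2)%R.

Definition normalize (m : nat) (x : nat -> R) : nat -> R :=
  fun i => if (i < m)%N then (x i / Num.sqrt (sqnorm m x))%R else 0%R.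

Definition ball_vol (m : nat) : \bar R :=
  iterint m (fun x => if (sqnorm m x <= 1)%R then 1 else 0).

Definition Esph (m : nat) (g : (nat -> R) -> \bar R) : \bar R :=
  iterint m (fun x => if (sqnorm m x <= 1)%R then g (normalize m x) else 0)
  * ((fine (ball_vol m))^-1)%:E.

Fixpoint Eseq (ms : seq nat) (G : seq (nat -> R) -> \bar R) : \bar R :=
  match ms with
  | [::] => G [::]
  | m :: ms' => Esph m (fun w => Eseq ms' (fun ws => G (w :: ws)))
  end.

End Sphere.

(* Main.v *)
(** The bounds on expectations follow from a small-ball estimate: for every eta
there is e > 0 such that, with probability at least 1 - eta, the features of two
nodes differ by at least e times the tree distance of their computation trees.
This form survives the induction on the depth. There are finitely many pairs of
neighbours, so outside a small event all pairs are separated at once, and so are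
their projections on a random direction; since the difference of two sorted lists
is realized by some matching, it is bounded below by the Wasserstein distance.
A last random direction does not cancel the resulting vector.

Neighbours matched with a blank need |x - z_k| bounded below. For k = 0 this is
compactness. For k > 0 the feature is x = d.w with d uniform on the sphere, and
z_k is not attainable, so |w| < |z_k|; as the component of d along a fixed
direction orthogonal to w is not small, d.w stays away from z_k by Bessel.

The integrals in the statement are iterated lower integrals. Bad events are
controlled by explicit measurable majorants instead, so that the measurability of
the network as a function of its parameters is not needed. *)

Require Import Defs.
From HB Require Import structures.
From mathcomp Require Import all_boot all_order all_algebra all_fingroup.
From mathcomp Require Import all_classical all_reals all_analysis.
From mathcomp Require Import measurable_realfun lra ring zify.
Import Order.TTheory GRing.Theory Num.Theory.
Import numFieldNormedType.Exports.
Local Open Scope ring_scope.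
Set Implicit Arguments.
Unset Strict Implicit.
Unset Printing Implicit Defensive.

(** * Upper bounds for iterated integrals of arbitrary functions *)

Section UpperBound.
Import HBNNSimple.
Variable R : realType.
Implicit Types (m : nat) (F : (nat -> R) -> R) (c : R).

(* The library integral of a nonnegative function is a supremum over simple
   functions, so this holds for [f] and [f'] that need not be measurable. *)
Lemma le_integral_add (f f' : R -> \bar R) (g : R -> R) (c : R) :
  measurable_fun setT g -> (forall t, 0 <= g t) ->
  (forall t, 0 <= f t)%E -> (forall t, 0 <= f' t)%E ->
  (forall t, f t <= f' t + (g t)%:E)%E ->
  (\int[@lebesgue_measure R]_t (g t)%:E <= c%:E)%E ->
  (\int[@lebesgue_measure R]_t f t <= \int[@lebesgue_measure R]_t f' t + c%:E)%E.
Proof.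
move=> mg g0 f0 f'0 fle gc.
rewrite ge0_integralTE; last exact: f0.
apply: ge_ereal_sup => _ [h /= hf <-].
(* [h] is simple, hence [s] is measurable; it lies below [f'] and satisfies [h <= s + g], so
   additivity is needed only for measurable functions. *)
pose s := fun t => Num.max (h t - g t) 0.
have s0 t : 0 <= s t by rewrite le_max lexx orbT.
have mh : measurable_fun setT h by [].
have ms : measurable_fun setT s.
  by apply: measurable_maxr => //; apply: measurable_funB.
have sf' t : ((s t)%:E <= f' t)%E.
  rewrite /s; case: (leP (h t - g t) 0) => _; first exact: f'0.
  by rewrite EFinB leeBlDr//; exact: le_trans (hf t) (fle t).
have hs t : h t <= s t + g t by rewrite -lerBlDr le_max lexx.
rewrite -integralT_nnsfun.
apply: (@le_trans _ _ (\int[lebesgue_measure]_t ((s t)%:E + (g t)%:E))%E).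
  apply: ge0_le_integral => //.
  - by move=> x _; rewrite lee_fin; exact: fun_ge0.
  - exact/measurable_EFinP.
  - by apply: emeasurable_funD; exact/measurable_EFinP.
  - by move=> x _; rewrite -EFinD lee_fin hs.
rewrite ge0_integralD//; [|by move=> *; rewrite lee_fin|exact/measurable_EFinP
  |by move=> *; rewrite lee_fin|exact/measurable_EFinP].
apply: leeD => //.
rewrite ge0_integralTE//.
apply: ge_ereal_sup => _ [k /= ks <-].
rewrite [leRHS]ge0_integralTE; last exact: f'0.
by apply: ereal_sup_ubound; exists k => // x; exact: le_trans (ks x) (sf' x).
Qed.

(* [ub m F c]: the upper iterated integral of [F] over [m] variables is at most
   [c], witnessed by measurable dominating functions. In contrast with
   [iterint] it is subadditive on arbitrary functions. *)
Fixpoint ub m F c : Prop :=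
  match m with
  | 0 => F (fun _ => 0) <= c
  | m'.+1 => exists g : R -> R,
      [/\ measurable_fun setT g, forall t, 0 <= g t,
          forall t, ub m' (fun x => F (upd x m' t)) (g t) &
          (\int[@lebesgue_measure R]_t (g t)%:E <= c%:E)%E]
  end.

Lemma ub_le m F F' c c' :
  (forall x, F' x <= F x) -> c <= c' -> ub m F c -> ub m F' c'.
Proof.
elim: m F F' c c' => [|m IH] F F' c c' FF cc /=.
  by move=> h; exact: le_trans (FF _) (le_trans h cc).
case=> g [mg g0 hg ig]; exists g; split => //.
  by move=> t; apply: IH (hg t).
by apply: le_trans ig _; rewrite lee_fin.
Qed.

Lemma ub_lec m F c c' : c <= c' -> ub m F c -> ub m F c'.
Proof. exact: ub_le. Qed.

Lemma ub_add m F F' c c' :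
  ub m F c -> ub m F' c' -> ub m (fun x => F x + F' x) (c + c').
Proof.
elim: m F F' c c' => [|m IH] F F' c c' /=; first exact: lerD.
case=> g [mg g0 hg ig] [g' [mg' g0' hg' ig']].
exists (fun t => g t + g' t); split.
- exact: measurable_funD.
- by move=> t; rewrite addr_ge0.
- by move=> t; exact: IH.
- under eq_integral do rewrite EFinD.
  rewrite ge0_integralD//; [|by move=> *; rewrite lee_fin|exact/measurable_EFinP
  |by move=> *; rewrite lee_fin|exact/measurable_EFinP].
  by rewrite EFinD leeD.
Qed.

Lemma ub_scale m F c k : 0 <= k -> ub m F c -> ub m (fun x => k * F x) (k * c).
Proof.
move=> k0; elim: m F c => [|m IH] F c /=; first exact: ler_wpM2l.
case=> g [mg g0 hg ig]; exists (fun t => k * g t); split.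
- exact: measurable_funM.
- by move=> t; rewrite mulr_ge0.
- by move=> t; exact: IH.
- under eq_integral do rewrite EFinM.
  rewrite ge0_integralZl//; [|exact/measurable_EFinP|by move=> *; rewrite lee_fin].
  by rewrite EFinM lee_wpmul2l// lee_fin.
Qed.

Lemma integral_itv (a b : R) : a <= b ->
  (\int[@lebesgue_measure R]_t (\1_(`[a, b]%classic : set R) t)%:E = (b - a)%:E)%E.
Proof.
move=> ab; rewrite integral_indic// setIT.
apply: (eq_trans (lebesgue_measure_itv `[a, b])).
rewrite /= lte_fin EFinB; case: ltgtP ab => // -> _.
by rewrite -EFinB subrr.
Qed.

Lemma ub_step m F (a b c : R) : a <= b -> 0 <= c ->
  (forall t, ub m (fun x => F (upd x m t)) (if a <= t <= b then c else 0)) ->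
  ub m.+1 F (c * (b - a)).
Proof.
move=> ab c0 h; exists (fun t => c * \1_(`[a, b]%classic : set R) t); split.
- by apply: measurable_funM => //.
- by move=> t; rewrite mulr_ge0// indicE.
- move=> t; apply: ub_le (h t) => //; rewrite indicE mem_setE in_itv /=.
  by case: ifP; rewrite ?mulr1 ?mulr0.
- under eq_integral do rewrite EFinM.
  rewrite ge0_integralZl//=; last first.
    by apply/measurable_EFinP.
  by rewrite integral_itv// -EFinM.
Qed.

Lemma iterint_ge0 m (f : (nat -> R) -> \bar R) :
  (forall x, 0 <= f x)%E -> (0 <= iterint m f)%E.
Proof.
elim: m f => [|m IH] f f0 //=.
by apply: integral_ge0 => t _; apply: IH.
Qed.

(** This replaces additivity of the iterated integral: the error [F] is charged through its
    majorants, while [f] and [f'] stay arbitrary. *)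
Lemma iterint_le_add m (f f' : (nat -> R) -> \bar R) F c :
  (forall x, 0 <= f x)%E -> (forall x, 0 <= f' x)%E ->
  (forall x, f x <= f' x + (F x)%:E)%E -> ub m F c ->
  (iterint m f <= iterint m f' + c%:E)%E.
Proof.
elim: m f f' F c => [|m IH] f f' F c f0 f'0 h /=.
  by move=> Fc; apply: le_trans (h _) _; rewrite leeD2l// lee_fin.
case=> g [mg g0 hg ig].
apply: (@le_integral_add _ _ g) => //.
- by move=> t; apply: iterint_ge0.
- by move=> t; apply: iterint_ge0.
- by move=> t; exact: (IH _ _ (fun x => F (upd x m t))).
Qed.

(** In each variable a multiple of the indicator of [[-r, r]] lies below the integrand, and a
    supremum over simple functions is monotone without measurability. *)
Lemma iterint_ge_box m (f : (nat -> R) -> \bar R) (r c : R) :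
  0 <= r -> 0 <= c -> (forall x, 0 <= f x)%E ->
  (forall x, (forall i, (i < m)%N -> `|x i| <= r) -> (c%:E <= f x)%E) ->
  ((c * (2 * r) ^+ m)%:E <= iterint m f)%E.
Proof.
move=> r0; elim: m f c => [|m IH] f c c0 f0 h /=.
  by rewrite expr0 mulr1; apply: h.
have k0 : 0 <= c * (2 * r) ^+ m by rewrite mulr_ge0// exprn_ge0// mulr_ge0.
apply: (@le_trans _ _ (\int[lebesgue_measure]_t (c * (2 * r) ^+ m * \1_(`[-r, r]%classic : set R) t)%:E)%E).
  under eq_integral do rewrite EFinM.
  rewrite ge0_integralZl//=; last first.
    by apply/measurable_EFinP.
  rewrite integral_itv; last lra.
  by rewrite exprSr mulrA EFinM lee_wpmul2l// lee_fin; lra.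
rewrite ge0_integralTE; last first.
  by move=> t; rewrite lee_fin mulr_ge0.
rewrite [leRHS]ge0_integralTE; last by move=> t; apply: iterint_ge0.
apply: ge_ereal_sup => _ [k /= ks <-].
apply: ereal_sup_ubound; exists k => // t; apply: le_trans (ks t) _.
rewrite indicE mem_setE in_itv /=.
have [tr|_] := boolP (- r <= t <= r)%R; rewrite ?mulr1 ?mulr0; last exact: iterint_ge0.
apply: IH => // x xr; apply: h => i; rewrite ltnS leq_eqVlt /upd => /predU1P[->|im].
  by rewrite eqxx ler_norml.
by rewrite (ltn_eqF im); exact: xr.
Qed.

Definition mx m (x : nat -> R) : R := \big[Num.max/0]_(i < m) `|x i|.

Lemma mx_ge0 m x : 0 <= mx m x.
Proof. by rewrite /mx; elim/big_ind: _ => // a b a0 b0; rewrite le_max a0. Qed.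

Lemma mx_ge m x i : (i < m)%N -> `|x i| <= mx m x.
Proof.
by move=> im; rewrite /mx (bigD1 (Ordinal im))//= le_max lexx.
Qed.

Lemma mx_le m x c : 0 <= c -> (forall i, (i < m)%N -> `|x i| <= c) -> mx m x <= c.
Proof.
by move=> c0 h; apply: bigmax_le => // i _; exact: h.
Qed.

Lemma mxS m x : mx m.+1 x = Num.max (mx m x) `|x m|.
Proof.
apply/eqP; rewrite eq_le; apply/andP; split.
  apply: mx_le => [|i]; first by rewrite le_max mx_ge0.
  by rewrite ltnS leq_eqVlt le_max => /predU1P[->|/mx_ge->//]; rewrite lexx orbT.
rewrite ge_max mx_ge// andbT; apply: mx_le => [|i im]; first exact: mx_ge0.
by apply: mx_ge; exact: ltnW.
Qed.

Definition ind (P : Prop) : R := (`[< P >])%:R.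

Lemma ind_le (P Q : Prop) : (P -> Q) -> ind P <= ind Q.
Proof.
move=> PQ; rewrite /ind ler_nat; case: asboolP => // p.
by rewrite asboolT//; exact: PQ.
Qed.

Lemma ind_ge0 (P : Prop) : 0 <= ind P. Proof. exact: ler0n. Qed.

Lemma indF (P : Prop) : ~ P -> ind P = 0.
Proof. by move=> nP; rewrite /ind asboolF. Qed.

Lemma ind_le1 (P : Prop) : ind P <= 1.
Proof. by rewrite /ind; case: asboolP. Qed.

Lemma ub0 m F c : (forall x, F x <= 0) -> 0 <= c -> ub m F c.
Proof.
elim: m F c => [|m IH] F c F0 c0 /=; first exact: le_trans (F0 _) c0.
exists (fun=> 0); split => //; first by move=> t; apply: IH.
by rewrite integral0.
Qed.

(** * Slabs in the unit cube *)

Definition in_box m (x : nat -> R) := forall i, (i < m)%N -> `|x i| <= 1.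

Lemma in_box_upd m (x : nat -> R) t : in_box m.+1 (upd x m t) -> in_box m x /\ `|t| <= 1.
Proof.
move=> h; split; last by have := h m (ltnSn m); rewrite /upd eqxx.
by move=> i im; have := h i (ltnW im); rewrite /upd (ltn_eqF im).
Qed.

Lemma ub_box m : ub m (fun x => ind (in_box m x)) (2 ^+ m).
Proof.
elim: m => [|m IH]; first by rewrite /= expr0 ind_le1.
have -> : 2 ^+ m.+1 = 2 ^+ m * (1 - (-1)) :> R by rewrite exprSr opprK.
apply: ub_step; [lra|exact: exprn_ge0|] => t.
case: ifPn => ht.
  by apply: ub_le IH => // x; apply: ind_le => /in_box_upd[].
by apply: ub0 => // x; rewrite indF// => /in_box_upd[_]; rewrite ler_norml; apply/negP.
Qed.

Lemma dot_upd m (x v : nat -> R) t : dot m.+1 (upd x m t) v = dot m x v + t * v m.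
Proof.
rewrite /dot big_ord_recr /= /upd eqxx; congr (_ + _).
by apply: eq_bigr => i _; rewrite (ltn_eqF (ltn_ord i)).
Qed.

Lemma dot_box m (x v : nat -> R) : in_box m x -> `|dot m x v| <= m%:R * mx m v.
Proof.
move=> bx; rewrite /dot; apply: le_trans (ler_norm_sum _ _ _) _.
apply: (@le_trans _ _ (\sum_(i < m) mx m v)); last first.
  by rewrite sumr_const card_ord mulr_natl.
apply: ler_sum => i _; rewrite normrM -[leRHS]mul1r.
by apply: ler_pM => //; [apply: bx|apply: mx_ge].
Qed.

(* Integrating over the coordinates one after the other needs no change of
   the order of integration: when the outermost coefficient dominates, the
   inner slab is empty unless the outer variable lies in a short interval. *)
Lemma ub_slab m : exists2 C : R, 0 <= C & forall (v : nat -> R) (c e r : R), 0 < e -> 0 < r -> r <= mx m v ->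
  ub m (fun x => ind (in_box m x /\ `|dot m x v - c| < e)) (C * e / r).
Proof.
elim: m => [|m [C C0 IH]].
  exists 0 => // v c e r e0 r0; rewrite /mx big_ord0 => r0'; lra.
pose C' := 2 * (1 + m%:R) * (2 ^+ m + C).
have m0 : 0 <= m%:R :> R by [].
have p0 : 0 <= 2 ^+ m :> R by exact: exprn_ge0.
have mp0 := mulr_ge0 m0 p0; have mC0 := mulr_ge0 m0 C0.
exists C'; first by rewrite /C'; lra.
move=> v c e r e0 r0 rv.
have step t x : in_box m.+1 (upd x m t) /\ `|dot m.+1 (upd x m t) v - c| < e ->
   [/\ in_box m x, `|t| <= 1 & `|dot m x v - (c - t * v m)| < e].
  case=> /in_box_upd[bx t1]; rewrite dot_upd => h; split => //.
  by move: h; congr (`| _ | < _); lra.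
have er0 : 0 < e / r by rewrite divr_gt0.
(* If an inner coefficient already has size [r], each slice lies in a slab with the same [e] and
   [r], and the outer variable only contributes the length 2. *)
have [rmu|mur] := leP r (mx m v).
  apply: (@ub_lec _ _ (C * e / r * (1 - -1))).
    have -> : C * e / r * (1 - -1) = C * 2 * (e / r) by lra.
    rewrite -(mulrA C'); apply: ler_wpM2r; first exact: ltW.
    by rewrite /C'; lra.
  apply: ub_step; [lra|by rewrite -mulrA mulr_ge0// ltW|] => t.
  case: ifPn => ht.
    apply: ub_le (IH v (c - t * v m) e r e0 r0 rmu) => // x.
    by apply: ind_le => /step[].
  by apply: ub0 => // x; rewrite indF// => /step[_]; rewrite ler_norml (negbTE ht).
have rvm : r <= `|v m|.
  by move: rv; rewrite mxS le_max leNgt mur.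
have vm0 : v m != 0 by rewrite -normr_gt0; lra.
set mu := mx m v in mur *.
have mu0 : 0 <= mu by exact: mx_ge0.
(* On the slab [t * v m] is within [e + m * mu] of [c], so [t] lies within [l] of [c / v m]. *)
pose l := (e + m%:R * mu) / `|v m|.
have l0 : 0 <= l by rewrite divr_ge0//; nra.
have key k : 0 <= k -> k * (l * 2) <= C' * e / r ->
    (forall c, ub m (fun x => ind (in_box m x /\ `|dot m x v - c| < e)) k) ->
    ub m.+1 (fun x => ind (in_box m.+1 x /\ `|dot m.+1 x v - c| < e)) (C' * e / r).
  move=> k0 kl hk.
  apply: (@ub_lec _ _ (k * ((c / v m + l) - (c / v m - l)))).
    by apply: le_trans kl; rewrite ler_wpM2l//; lra.
  apply: ub_step => //; first lra.
  move=> t; case: ifPn => ht.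
    by apply: ub_le (hk (c - t * v m)) => // x; apply: ind_le => /step[].
  apply: ub0 => // x; rewrite indF// => /step[bx _ h].
  move: ht; apply/negP/negPn.
  have db := dot_box v bx.
  have h1 : `|t * v m - c| <= e + m%:R * mu.
    have -> : t * v m - c = (dot m x v - (c - t * v m)) - dot m x v by lra.
    by apply: le_trans (ler_normB _ _) _; apply: lerD => //; apply: ltW.
  have : `|t - c / v m| <= l.
    rewrite /l ler_pdivlMr ?normr_gt0// -normrM mulrBl divfK//.
  by rewrite ler_norml => /andP[? ?]; apply/andP; split; lra.
have lr : l <= (e + m%:R * mu) / r.
  rewrite /l ler_wpM2l//; first nra.
  by rewrite lef_pV2// posrE; lra.
(* If [mu <= e] the window for [t] is of order [e / r], and the cube volume bounds the slices.
   Otherwise the window is of order [mu / r] and the induction hypothesis with [r := mu] bounds the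
   slices by [C * e / mu], so [mu] cancels. *)
have [mue|emu] := leP mu e.
  apply: (key (2 ^+ m)) => //; last first.
    by move=> c'; apply: ub_le (ub_box m) => // x; apply: ind_le => -[].
  apply: (@le_trans _ _ (2 ^+ m * ((1 + m%:R) * (e / r) * 2))).
    rewrite ler_wpM2l// ler_wpM2r//; apply: le_trans lr _.
    by rewrite mulrA ler_pM2r ?invr_gt0//; nra.
  rewrite /C' -mulrA; nra.
have mu1 : 0 < mu by lra.
have em0 : 0 < e / mu by rewrite divr_gt0.
apply: (key (C * e / mu)).
- by rewrite -mulrA mulr_ge0// ltW.
- apply: (@le_trans _ _ (C * e / mu * ((1 + m%:R) * mu / r * 2))).
    rewrite ler_wpM2l//; first by rewrite -mulrA mulr_ge0// ltW.
    rewrite ler_wpM2r//; apply: le_trans lr _.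
    by rewrite ler_pM2r ?invr_gt0//; nra.
  have -> : C * e / mu * ((1 + m%:R) * mu / r * 2) = 2 * (1 + m%:R) * C * (e / r).
    by field; rewrite !gt_eqF.
  rewrite /C' -[leRHS]mulrA ler_wpM2r//; first exact: ltW.
  lra.
- by move=> c'; apply: IH.
Qed.


(** * The uniform measure on spheres *)

Lemma sqnorm_ge0 m (x : nat -> R) : 0 <= sqnorm m x.
Proof. by apply: sumr_ge0 => i _; exact: sqr_ge0. Qed.

Lemma sqr_le_sqnorm m (x : nat -> R) i : (i < m)%N -> x i ^+ 2 <= sqnorm m x.
Proof.
move=> im; rewrite /sqnorm (bigD1 (Ordinal im))//= lerDl.
by apply: sumr_ge0 => j _; exact: sqr_ge0.
Qed.

Lemma ball_in_box m (x : nat -> R) : sqnorm m x <= 1 -> in_box m x.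
Proof.
move=> h i im; have := le_trans (sqr_le_sqnorm x im) h.
by rewrite -real_normK ?num_real// expr_le1.
Qed.

Definition vol m : R := fine (ball_vol R m).

(** The ball lies between the cubes of half-side [1 / (m + 1)] and 1, so its volume is finite and
    positive and dividing by its [fine] part is meaningful. *)
Lemma ball_volE m : ball_vol R m = (vol m)%:E /\ 0 < vol m.
Proof.
have le2 : (ball_vol R m <= (2 ^+ m)%:E)%E.
  have := @iterint_le_add m (fun x => if (sqnorm m x <= 1)%R then 1 else 0)%E
     (fun=> 0%E) (fun x => ind (in_box m x)) (2 ^+ m).
  rewrite /ball_vol.
  have -> : iterint m (fun=> 0%E : \bar R) = 0%E.
    by elim: m => //= m ->; rewrite integral0.
  rewrite add0e; apply => //; last exact: ub_box.
    by move=> x; case: ifP.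
  move=> x; rewrite add0e; case: ifP => [/ball_in_box h|_]; last by rewrite lee_fin ind_ge0.
  by rewrite /ind asboolT.
have gt0 : (0 < ball_vol R m)%E.
  pose r : R := m.+1%:R^-1.
  have r0 : 0 < r by rewrite invr_gt0.
  apply: (@lt_le_trans _ _ (1 * (2 * r) ^+ m)%:E).
    by rewrite lte_fin mul1r exprn_gt0// mulr_gt0.
  apply: iterint_ge_box => //; first exact: ltW.
    by move=> x; case: ifP.
  move=> x h; rewrite ifT// /sqnorm.
  apply: (@le_trans _ _ (\sum_(i < m) r)).
    apply: ler_sum => i _; apply: (@le_trans _ _ (r * r)).
      by rewrite -expr2 -real_normK ?num_real// ler_sqr ?nnegrE ?(ltW r0)// h.
    by rewrite -[leRHS]mulr1 ler_wpM2l ?(ltW r0)// invf_le1 ?ler1n.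
  rewrite sumr_const card_ord -mulr_natl /r ler_pdivrMr// mul1r ler_nat//.
have fin : ball_vol R m \is a fin_num.
  rewrite ge0_fin_numE; last exact: ltW.
  exact: le_lt_trans le2 (ltry _).
split; first by rewrite /vol fineK.
by rewrite -lte_fin /vol fineK.
Qed.

Lemma vol_gt0 m : 0 < vol m. Proof. by case: (ball_volE m). Qed.

Definition usph m (g : (nat -> R) -> R) c : Prop :=
  ub m (fun x => if sqnorm m x <= 1 then g (normalize m x) else 0) (c * vol m).

Lemma usph_le m g g' c c' : (forall w, g' w <= g w) -> c <= c' ->
  usph m g c -> usph m g' c'.
Proof.
move=> gg cc; apply: ub_le; last by rewrite ler_wpM2r// ltW// vol_gt0.
by move=> x; case: ifP.
Qed.

Lemma usph_add m g g' c c' : usph m g c -> usph m g' c' ->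
  usph m (fun w => g w + g' w) (c + c').
Proof.
move=> h h'; rewrite /usph mulrDl; apply: ub_le (ub_add h h') => // x.
by case: ifP; rewrite ?addr0.
Qed.

Lemma usph_scale m g c k : 0 <= k -> usph m g c -> usph m (fun w => k * g w) (k * c).
Proof.
move=> k0 h; rewrite /usph -mulrA; apply: ub_le (ub_scale k0 h) => // x.
by case: ifP; rewrite ?mulr0.
Qed.

(** The enclosing cube replaces the ball, so the constant is a ratio of volumes; any constant
    independent of [k] suffices. *)
Lemma usph_const m : exists2 C : R, 0 < C & forall k : R, 0 <= k -> usph m (fun=> k) (C * k).
Proof.
exists (2 ^+ m / vol m); first by rewrite divr_gt0 ?vol_gt0// exprn_gt0.
move=> k k0; rewrite /usph mulrAC divfK ?gt_eqF ?vol_gt0//.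
rewrite mulrC; apply: ub_le (ub_scale k0 (ub_box m)) => // x.
case: ifP => [/ball_in_box h|_]; last by rewrite mulr_ge0// ind_ge0.
by rewrite /ind asboolT// mulr1.
Qed.

Lemma dot_normalize m (x v : nat -> R) :
  dot m x v = Num.sqrt (sqnorm m x) * dot m (normalize m x) v.
Proof.
rewrite /dot mulr_sumr; apply: eq_bigr => i _.
rewrite /normalize ltn_ord; have [s0|s0] := eqVneq (Num.sqrt (sqnorm m x)) 0; last first.
  by rewrite mulrA mulrC (mulrC (x i)) mulrA mulfV// mul1r mulrC.
have : x i ^+ 2 <= 0.
  apply: le_trans (sqr_le_sqnorm x (ltn_ord i)) _.
  by rewrite -sqrtr_eq0 s0.
move=> h; have : x i ^+ 2 == 0 by rewrite eq_le h sqr_ge0.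
by rewrite sqrf_eq0 s0 => /eqP ->; rewrite !mul0r.
Qed.

(** In the ball [|x| <= 1], so normalising can only increase [|dot m x v|], and the cone over a
    spherical slab lies in a flat slab. Measuring thickness relative to [mx m v] makes the bound
    independent of [v]. *)
Lemma usph_slab m : exists2 C : R, 0 <= C & forall (e : R) (v : nat -> R), 0 < e ->
  usph m (fun w => ind (`|dot m w v| < e * mx m v)) (C * e).
Proof.
have [C C0 h] := ub_slab m.
have v0 := vol_gt0 m.
exists (C / vol m) => [|e v e0]; first by rewrite divr_ge0// ltW.
rewrite /usph mulrAC divfK ?gt_eqF//.
have [mx0|] := leP (mx m v) 0.
  apply: ub0 => [x|]; last by rewrite mulr_ge0// ltW.
  case: ifP => // _; rewrite indF// => hh.
  have := normr_ge0 (dot m (normalize m x) v); nra.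
move=> mx0; have em0 : 0 < e * mx m v by rewrite mulr_gt0.
have := h v 0 (e * mx m v) (mx m v) em0 mx0 (lexx _).
rewrite mulrA mulfK ?gt_eqF//; apply: ub_le => // x.
case: ifP => [s1|_]; last exact: ind_ge0.
apply: ind_le => hx; split; first exact: ball_in_box.
rewrite subr0 dot_normalize normrM (ger0_norm (sqrtr_ge0 _)).
apply: le_lt_trans hx; rewrite -[leRHS]mul1r ler_wpM2r//.
by rewrite -sqrtr1 ler_wsqrtr.
Qed.

Lemma on_sphere_normalize m (x : nat -> R) : sqnorm m x != 0 -> on_sphere m (normalize m x).
Proof.
move=> s0; rewrite /on_sphere.
under eq_bigr => i _ do rewrite /normalize ltn_ord expr_div_n sqr_sqrtr ?sqnorm_ge0//.
by rewrite -mulr_suml divff.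
Qed.

(** Normalisation fails only at the origin, which lies in slabs of arbitrarily small mass. *)
Lemma usph_not_sphere m : (0 < m)%N -> forall eta : R, 0 < eta ->
  usph m (fun w => ind (~ on_sphere m w)) eta.
Proof.
move=> m0 eta eta0; have [C C0 h] := usph_slab m.
pose v (i : nat) : R := (i == 0%N)%:R.
pose e := eta / (C + 1).
have C1 : 0 < C + 1 by lra.
have e0 : 0 < e by rewrite divr_gt0.
apply: ub_le (h e v e0).
  move=> x; case: ifP => // _; apply: ind_le => hx.
  have /eqP s0 : sqnorm m x == 0.
    by apply/negPn/negP => /on_sphere_normalize.
  have mv : 0 < mx m v.
    by apply: lt_le_trans (mx_ge v m0); rewrite /v eqxx normr1.
  apply: (@le_lt_trans _ _ 0); last by rewrite mulr_gt0.
  rewrite /dot big1 ?normr0// => i _.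
  by rewrite /normalize ltn_ord s0 sqrtr0 invr0 mulr0 mul0r.
rewrite ler_pM2r ?vol_gt0// /e mulrCA ler_piMr ?(ltW eta0)//.
by rewrite ler_pdivrMr//; lra.
Qed.

(* The counterpart of [ub] for [Eseq]. *)
Fixpoint ue (ms : seq nat) (F : seq (nat -> R) -> R) c : Prop :=
  match ms with
  | [::] => F [::] <= c
  | m :: ms' => exists g : (nat -> R) -> R,
      [/\ forall w, 0 <= g w, forall w, ue ms' (fun ws => F (w :: ws)) (g w) &
          usph m g c]
  end.

Implicit Types (G : seq (nat -> R) -> R).

Lemma ue_le ms G G' c c' :
  (forall ws, size ws = size ms -> G' ws <= G ws) -> c <= c' -> ue ms G c -> ue ms G' c'.
Proof.
elim: ms G G' c c' => [|m ms IH] G G' c c' GG cc /=.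
  by move=> h; exact: le_trans (GG _ _) (le_trans h cc).
case=> g [g0 hg ig]; exists g; split => //; last exact: usph_le ig.
by move=> w; apply: IH (hg w) => // ws sw; apply: GG; rewrite /= sw.
Qed.

Lemma ue_add ms G G' c c' : ue ms G c -> ue ms G' c' ->
  ue ms (fun ws => G ws + G' ws) (c + c').
Proof.
elim: ms G G' c c' => [|m ms IH] G G' c c' /=; first exact: lerD.
case=> g [g0 hg ig] [g' [g0' hg' ig']]; exists (fun w => g w + g' w); split.
- by move=> w; rewrite addr_ge0.
- by move=> w; exact: IH.
- exact: usph_add.
Qed.

Lemma ue_scale ms G c k : 0 <= k -> ue ms G c -> ue ms (fun ws => k * G ws) (k * c).
Proof.
move=> k0; elim: ms G c => [|m ms IH] G c /=; first exact: ler_wpM2l.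
case=> g [g0 hg ig]; exists (fun w => k * g w); split.
- by move=> w; rewrite mulr_ge0.
- by move=> w; exact: IH.
- exact: usph_scale.
Qed.

Lemma ue_const ms : exists2 C : R, 0 < C & forall k : R, 0 <= k -> ue ms (fun=> k) (C * k).
Proof.
elim: ms => [|m ms [C C0 IH]]; first by exists 1 => // k _ /=; rewrite mul1r.
have [D D0 hD] := usph_const m.
exists (D * C) => [|k k0]; first exact: mulr_gt0.
have Ck : 0 <= C * k by rewrite mulr_ge0// ltW.
by exists (fun=> C * k); split => // [w|]; [exact: IH|rewrite -mulrA; exact: hD].
Qed.

(** An outer-measure form of probability at most [c]: it makes sense for every [A], and finite
    unions are handled by subadditivity. *)
Definition pr ms (A : seq (nat -> R) -> Prop) c := ue ms (fun ws => ind (A ws)) c.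

Lemma pr_le ms (A A' : seq (nat -> R) -> Prop) c c' :
  (forall ws, size ws = size ms -> A' ws -> A ws) -> c <= c' -> pr ms A c -> pr ms A' c'.
Proof.
by move=> AA cc; apply: ue_le => // ws sw; apply: ind_le; exact: AA.
Qed.

Lemma pr_false ms (A : seq (nat -> R) -> Prop) c :
  (forall ws, size ws = size ms -> ~ A ws) -> 0 <= c -> pr ms A c.
Proof.
move=> nA c0; have [C _ h] := ue_const ms.
apply: ue_le (h 0 (lexx _)) => [ws sw|]; first by rewrite indF//; exact: nA.
by rewrite mulr0.
Qed.

Lemma pr_or ms (A B : seq (nat -> R) -> Prop) a b :
  pr ms A a -> pr ms B b -> pr ms (fun ws => A ws \/ B ws) (a + b).
Proof.
move=> ha hb; apply: ue_le (ue_add ha hb) => // ws _; rewrite /ind.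
case: asboolP => [[h|h]|_]; last by rewrite addr_ge0.
  by rewrite (asboolT h) lerDl.
by rewrite (asboolT h) lerDr.
Qed.

Lemma pr_exists (I : finType) ms (A : I -> seq (nat -> R) -> Prop) a : 0 <= a ->
  (forall i, pr ms (A i) a) -> pr ms (fun ws => exists i, A i ws) (#|I|%:R * a).
Proof.
move=> a0 h.
have hs (s : seq I) : pr ms (fun ws => exists2 i, i \in s & A i ws) ((size s)%:R * a).
  elim: s => [|i s IH]; first by apply: pr_false => [ws _ []|]; rewrite ?mul0r.
  rewrite /= -natr1 mulrDl mul1r addrC; apply: pr_le (pr_or (h i) IH) => // ws _.
  by case=> j; rewrite inE => /predU1P[->|js] Aj; [left|right; exists j].
rewrite cardE; apply: pr_le (hs (enum I)) => // ws _ [i Ai].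
by exists i => //; rewrite mem_enum.
Qed.

(** [V] sees only the parameters drawn before the [i]-th, so it is a fixed vector when that one is
    integrated. The constant [e] is chosen before [V], which gives uniformity over all graphs. *)
Lemma pr_nth_slab ms i : (i < size ms)%N -> forall eta : R, 0 < eta ->
  exists2 e : R, 0 < e & forall V : seq (nat -> R) -> nat -> R,
    pr ms (fun ws => `|dot (nth 0%N ms i) (par ws i) (V (take i ws))|
                     < e * mx (nth 0%N ms i) (V (take i ws))) eta.
Proof.
elim: ms i => [//|m ms IH] [_|i] /=.
  move=> eta eta0; have [C C0 hC] := usph_slab m; have [D D0 hD] := ue_const ms.
  (* [D] pays for integrating over the remaining parameters, and [C + 1] instead of [C] keeps the
     denominator positive. *)
  pose e := eta / (D * (C + 1)).
  have C1 : 0 < C + 1 by lra.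
  have e0 : 0 < e by rewrite divr_gt0// mulr_gt0.
  exists e => // V.
  exists (fun w => D * ind (`|dot m w (V [::])| < e * mx m (V [::]))); split.
  - by move=> w; rewrite mulr_ge0 ?ind_ge0// ltW.
  - move=> w; have := hD _ (ind_ge0 (`|dot m w (V [::])| < e * mx m (V [::]))).
    by apply: ue_le.
  - have := usph_scale (ltW D0) (hC e (V [::]) e0); apply: usph_le => //.
    have -> : D * (C * e) = eta * (C / (C + 1)).
      by rewrite /e; field; rewrite !gt_eqF.
    by rewrite ler_piMr ?(ltW eta0)// ler_pdivrMr//; lra.
rewrite ltnS => ims eta eta0; have [D D0 hD] := usph_const m.
have ed : 0 < eta / D by rewrite divr_gt0.
have [e e0 he] := IH i ims _ ed.
exists e => // V; exists (fun=> eta / D); split.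
- by move=> w; rewrite ltW// divr_gt0.
- by move=> w; exact: (he (fun s => V (w :: s))).
- by have := hD _ (ltW ed); rewrite (mulrC D) divfK ?gt_eqF.
Qed.

Lemma pr_not_sphere ms i : (i < size ms)%N -> (0 < nth 0%N ms i)%N ->
  forall eta : R, 0 < eta -> pr ms (fun ws => ~ on_sphere (nth 0%N ms i) (par ws i)) eta.
Proof.
elim: ms i => [//|m ms IH] [_|i] /=.
  move=> m0 eta eta0; have [D D0 hD] := ue_const ms.
  have ed : 0 < eta / D by rewrite divr_gt0.
  exists (fun w => D * ind (~ on_sphere m w)); split.
  - by move=> w; rewrite mulr_ge0 ?ind_ge0// ltW.
  - by move=> w; have := hD _ (ind_ge0 (~ on_sphere m w)); apply: ue_le.
  - apply: usph_le (usph_scale (ltW D0) (usph_not_sphere m0 ed)) => //.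
    by rewrite mulrC divfK// gt_eqF.
rewrite ltnS => ims m0 eta eta0; have [D D0 hD] := usph_const m.
have ed : 0 < eta / D by rewrite divr_gt0.
exists (fun=> eta / D); split.
- by move=> w; rewrite ltW// divr_gt0.
- by move=> w; exact: IH.
- by have := hD _ (ltW ed); rewrite (mulrC D) divfK ?gt_eqF.
Qed.

(** * From small bad events to lower bounds on expectations *)

Lemma Eseq_ge0 ms (f : seq (nat -> R) -> \bar R) :
  (forall ws, 0 <= f ws)%E -> (0 <= Eseq ms f)%E.
Proof.
elim: ms f => [|m ms IH] f f0 /=; first exact: f0.
rewrite /Esph mule_ge0//; last by rewrite lee_fin invr_ge0 ltW// vol_gt0.
by apply: iterint_ge0 => x; case: ifP => // _; exact: IH.
Qed.

Lemma Eseq_le_add ms (f f' : seq (nat -> R) -> \bar R) G c : 0 <= c ->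
  (forall ws, 0 <= f ws)%E -> (forall ws, 0 <= f' ws)%E ->
  (forall ws, size ws = size ms -> f ws <= f' ws + (G ws)%:E)%E -> ue ms G c ->
  (Eseq ms f <= Eseq ms f' + c%:E)%E.
Proof.
elim: ms f f' G c => [|m ms IH] f f' G c c0 f0 f'0 h /=.
  by move=> Fc; apply: le_trans (h _ _) _ => //; rewrite leeD2l// lee_fin.
case=> g [g0 hg ig].
have v0 := vol_gt0 m; have vi0 : (0 <= ((vol m)^-1)%:E)%E by rewrite lee_fin invr_ge0 ltW.
rewrite /Esph -/(vol m).
have -> : c%:E = ((c * vol m)%:E * ((vol m)^-1)%:E)%E.
  by rewrite -EFinM mulfK// gt_eqF.
rewrite -ge0_muleDl; last 2 first.
- by apply: iterint_ge0 => x; case: ifP => // _; exact: Eseq_ge0.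
- by rewrite lee_fin mulr_ge0// ltW.
apply: lee_wpmul2r => //.
apply: iterint_le_add ig.
- by move=> x; case: ifP => // _; exact: Eseq_ge0.
- by move=> x; case: ifP => // _; exact: Eseq_ge0.
- move=> x; case: ifP => // _; last by rewrite add0e.
  apply: (IH _ _ (fun ws => G (normalize m x :: ws))) => // ws sw.
  by apply: h; rewrite /= sw.
Qed.

(** The ball contains a small cube, and the volume of the cube over that of the ball enters [k] at
    each step. *)
Lemma Eseq_const_ge ms : exists2 k : R, 0 < k & forall M : R, 0 <= M ->
  ((k * M)%:E <= Eseq ms (fun=> M%:E))%E.
Proof.
elim: ms => [|m ms [k k0 IH]]; first by exists 1 => // M _ /=; rewrite mul1r.
have v0 := vol_gt0 m.
pose r : R := m.+1%:R^-1.
have r0 : 0 < r by rewrite invr_gt0.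
have p0 : 0 < (2 * r) ^+ m by rewrite exprn_gt0// mulr_gt0.
exists (k * (2 * r) ^+ m / vol m); first by rewrite divr_gt0// mulr_gt0.
move=> M M0 /=; rewrite /Esph -/(vol m) mulrAC EFinM.
apply: lee_wpmul2r; first by rewrite lee_fin invr_ge0 ltW.
have -> : k * (2 * r) ^+ m * M = k * M * (2 * r) ^+ m by lra.
apply: iterint_ge_box => //; [exact: ltW|by rewrite mulr_ge0// ltW| |].
  by move=> x; case: ifP => // _; apply: Eseq_ge0.
move=> x h; rewrite ifT; first exact: IH.
apply: (@le_trans _ _ (\sum_(i < m) r)).
  apply: ler_sum => i _; apply: (@le_trans _ _ (r * r)).
    by rewrite -expr2 -real_normK ?num_real// ler_sqr ?nnegrE ?(ltW r0)// h.
  by rewrite -[leRHS]mulr1 ler_wpM2l ?(ltW r0)// invf_le1 ?ler1n.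
by rewrite sumr_const card_ord -mulr_natl /r ler_pdivrMr// mul1r ler_nat.
Qed.

(* Only a lower bound with the factor [k] is available for constants, so the bad
   event is required to have mass at most [k / 2]. *)
Lemma Eseq_ge_of_pr ms : exists2 k : R, 0 < k &
  forall (f : seq (nat -> R) -> \bar R) (A : seq (nat -> R) -> Prop) M, 0 <= M ->
  (forall ws, 0 <= f ws)%E ->
  (forall ws, size ws = size ms -> ~ A ws -> M%:E <= f ws)%E ->
  pr ms A (k / 2) -> ((k / 2 * M)%:E <= Eseq ms f)%E.
Proof.
have [k k0 hk] := Eseq_const_ge ms.
exists k => // f A M M0 f0 hf hA.
have := hk M M0.
have k2 : 0 <= M * (k / 2) by rewrite mulr_ge0// divr_ge0// ltW.
have := @Eseq_le_add ms (fun=> M%:E) f (fun ws => M * ind (A ws)) (M * (k / 2)) k2.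
move=> /(_ (fun=> _)) /(_ f0) h1 h2.
(* On lists of the right length [M <= f + M * ind A], and the second term accounts for at most half
   of the lower bound [k * M]. *)
have h3 : ((k * M)%:E <= Eseq ms f + (M * (k / 2))%:E)%E.
  apply: le_trans h2 (h1 _ _ _) => //; last exact: ue_scale.
  move=> ws sw; rewrite /ind; case: asboolP => Aw; rewrite ?mulr1 ?mulr0.
    by rewrite leeDr.
  by rewrite adde0; exact: hf.
rewrite -leeBlDr// -EFinB in h3.
by apply: le_trans h3; rewrite lee_fin; lra.
Qed.

End UpperBound.

(** * Tree distances and sorting *)

Section Trees.
Variables (R : realType) (p : R) (d n : nat) (zt : 'rV[R]_d).
Hypothesis p1 : 1 <= p.
Notation T := (tree 'rV[R]_d).
Notation blank := (blank_tree zt).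
Notation pd A i := (nth blank (pad n zt A) i).
Implicit Types (A B : seq T) (dist : T -> T -> R) (a b : T).

(** Up to a permutation, padding at the end of the list amounts to putting a blank at each index
    outside [P]. This matches the network, which puts [z_k] at these indices. *)
Lemma pad_perm (P : pred 'I_n) (f : 'I_n -> T) : exists s : 'S_n, forall j : 'I_n,
  pd [seq f i | i <- enum 'I_n & P i] j = if P (s j) then f (s j) else blank.
Proof.
pose L := [seq i <- enum 'I_n | P i] ++ [seq i <- enum 'I_n | ~~ P i].
have pL : perm_eq L (enum 'I_n) by rewrite perm_filterC.
have uL : uniq L by rewrite (perm_uniq pL) enum_uniq.
have sL : size L = n by rewrite (perm_size pL) size_enum_ord.
have injL : injective (fun j : 'I_n => nth j L j).
  move=> j j' /eqP; rewrite (set_nth_default j) ?sL// nth_uniq ?sL//.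
  by move/eqP/val_inj.
exists (perm injL) => j; rewrite permE /pad size_map.
rewrite nth_cat size_map nth_cat; case: ltnP => jl.
  rewrite (nth_map j)//.
  by have := mem_nth j jl; rewrite mem_filter => /andP[-> _].
set i := nth j _ _.
have : i \in [seq i <- enum 'I_n | ~~ P i].
  apply: mem_nth; rewrite -(ltn_add2l (size [seq i <- enum 'I_n | P i])).
  by rewrite subnKC// -size_cat -/L sL.
rewrite mem_filter => /andP[/negbTE-> _].
by rewrite nth_nseq if_same.
Qed.

Lemma Wdist_le dist A B (s : 'S_n) :
  Wdist n zt dist A B <= \sum_(j < n) dist (pd A j) (pd B (s j)).
Proof. by rewrite /Wdist; apply: bigmin_le_cond. Qed.

Lemma Wdist_ge0 dist A B : (forall a b, 0 <= dist a b) -> 0 <= Wdist n zt dist A B.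
Proof.
by move=> h; rewrite /Wdist; apply: le_bigmin => [|s _]; apply: sumr_ge0.
Qed.

Lemma eq_Wdist dist dist' A B :
  (forall i j, dist (pd A i) (pd B j) = dist' (pd A i) (pd B j)) ->
  Wdist n zt dist A B = Wdist n zt dist' A B.
Proof.
move=> h; have E (s : 'S_n) : \sum_(j < n) dist (pd A j) (pd B (s j)) =
    \sum_(j < n) dist' (pd A j) (pd B (s j)) by apply: eq_bigr => j _.
by rewrite /Wdist E; apply: eq_bigr => s _.
Qed.

Lemma pad_nth A i : (exists2 j, (j < size A)%N & pd A i = nth blank A j) \/ pd A i = blank.
Proof.
rewrite /pad nth_cat; case: ltnP => h; first by left; exists i.
by right; rewrite nth_nseq if_same.
Qed.

Lemma pad_map_ind (Q : T -> Prop) (I : eqType) (f : I -> T) (L : seq I) i : Q blank ->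
  (forall s, s \in L -> Q (f s)) -> Q (pd [seq f s | s <- L] i).
Proof.
move=> Qb h; case: (pad_nth (map f L) i) => [[j jL ->]|-> //].
have /hasP : has (fun=> true) L by rewrite has_predT; case: L jL {h}.
case=> x0 _ _; rewrite size_map in jL.
by rewrite (nth_map x0)//; apply/h/mem_nth.
Qed.

Lemma depth_nth (x : 'rV[R]_d) A j : (j < size A)%N -> (depth (nth blank A j) < depth (Node x A))%N.
Proof.
move=> jA; have -> : depth (Node x A) = (foldr maxn 0%N (map (@depth _) A)).+1.
  by case: A jA.
rewrite ltnS; elim: A j jA => [//|t A IH] [_|j] /=; first exact: leq_maxl.
by rewrite ltnS => /IH h; apply: leq_trans h (leq_maxr _ _).
Qed.

Lemma depth_pad k (x : 'rV[R]_d) A i : (depth (Node x A) <= k.+1)%N -> (depth (pd A i) <= k)%N.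
Proof.
move=> h; case: (pad_nth A i) => [[j jA ->]|-> //].
by rewrite -ltnS; apply: leq_trans h; exact: depth_nth.
Qed.

Lemma TDf_ge0 k a b : 0 <= TDf p n zt k a b.
Proof.
elim: k a b => [|k IH] a b /=; first exact: powR_ge0.
by case: ifP => _; rewrite ?addr_ge0 ?powR_ge0// Wdist_ge0.
Qed.

Lemma root_le_TDf k a b : pnorm_rV p (root_feat a - root_feat b) <= TDf p n zt k a b.
Proof.
by case: k => [|k] //=; case: ifP => _ //; rewrite lerDl Wdist_ge0// => *; exact: TDf_ge0.
Qed.

(** Passing to children lowers the depth and padding adds only trees of depth 0, so fuel beyond both
    depths is never consumed. With fuel fixed at [k] the distance recurses in step with the
    layers. *)
Lemma TDfS k a b : (depth a <= k)%N -> (depth b <= k)%N ->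
  TDf p n zt k.+1 a b = TDf p n zt k a b.
Proof.
elim: k a b => [|k IH] [x A] [y B] ha hb.
  by case: A ha => //; case: B hb.
change (TDf p n zt k.+2 (Node x A) (Node y B)) with
  (if nilp A && nilp B then pnorm_rV p (x - y) else
     pnorm_rV p (x - y) + Wdist n zt (TDf p n zt k.+1) A B).
rewrite [RHS]/=; case: ifP => // _; congr (_ + _).
by apply: eq_Wdist => i j; apply: IH; [exact: depth_pad ha|exact: depth_pad hb].
Qed.

Lemma TDE k a b : (depth a <= k)%N -> (depth b <= k)%N -> TD p n zt a b = TDf p n zt k a b.
Proof.
move=> ha hb; rewrite /TD; set m := maxn _ _.
have mk : (m <= k)%N by rewrite geq_max ha.
rewrite -(subnKC mk); elim: (k - m)%N => [|j IH]; first by rewrite addn0.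
rewrite addnS TDfS//; apply: leq_trans (leq_addr _ _).
  exact: leq_maxl.
exact: leq_maxr.
Qed.

Lemma depth_comp_tree (G : graph R d n) k v : (depth (comp_tree G k v) <= k)%N.
Proof.
elim: k v => [//|k IH] v /=.
case: [seq s <- enum 'I_n | gE G v s] => [//|s l].
change (foldr maxn 0%N (map (@depth _) (map (comp_tree G k) (s :: l))) <= k)%N.
by elim: (s :: l) => [//|s' l' IH'] /=; rewrite geq_max IH IH'.
Qed.

Lemma TMDE K (G H : graph R d n) : TMD p zt K G H =
  Wdist n zt (TDf p n zt K) [seq comp_tree G K v | v <- enum (gV G)]
    [seq comp_tree H K v | v <- enum (gV H)].
Proof.
apply: eq_Wdist => i j.
have h (F : graph R d n) l : (depth (pd [seq comp_tree F K v | v <- enum (gV F)] l) <= K)%N.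
  by apply: (pad_map_ind (Q := fun t => depth t <= K)%N) => // s _; exact: depth_comp_tree.
by apply: TDE; exact: h.
Qed.

Fixpoint feats_in (P : 'rV[R]_d -> Prop) k a : Prop :=
  P (root_feat a) /\
  if k is k'.+1 then forall i, feats_in P k' (pd (children a) i) else True.

(** A node matched with a blank is separated from it by a fixed gap only, so its tree distance must
    be bounded above; the identity matching suffices. *)
Lemma TDf_bounded (P : 'rV[R]_d -> Prop) (N : R) k : 0 <= N ->
  (forall x y, P x -> P y -> pnorm_rV p (x - y) <= N) ->
  exists2 D : R, 0 <= D & forall a b, feats_in P k a -> feats_in P k b -> TDf p n zt k a b <= D.
Proof.
move=> N0 hN; elim: k => [|k [D D0 IH]].
  by exists N => // a b /= [Pa _] [Pb _]; exact: hN.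
exists (N + n%:R * D) => [|a b [Pa ha] [Pb hb]]; first by rewrite addr_ge0// mulr_ge0.
rewrite /=; case: ifP => _; first by apply: le_trans (hN _ _ Pa Pb) _; rewrite lerDl mulr_ge0.
apply: lerD; first exact: hN.
apply: le_trans (Wdist_le _ _ _ 1%g) _.
apply: (@le_trans _ _ (\sum_(j < n) D)); first by apply: ler_sum => j _; apply: IH; [exact: ha|exact: hb].
by rewrite sumr_const card_ord mulr_natl.
Qed.

Lemma feats_in_blank (P : 'rV[R]_d -> Prop) k : P zt -> feats_in P k blank.
Proof.
move=> Pz; elim: k => [|k IH] //=; split => // i.
by case: (pad_nth [::] i) => [[]//|->].
Qed.

Lemma feats_in_comp_tree Omega (P : 'rV[R]_d -> Prop) (G : graph R d n) k v :
  valid_graph Omega G -> (forall x, Omega x -> P x) -> P zt -> v \in gV G ->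
  feats_in P k (comp_tree G k v).
Proof.
move=> vG OP Pz; have [hE _ _ hX] := vG.
elim: k v => [|k IH] v vV /=; first by split => //; apply/OP/hX.
split; first exact/OP/hX.
move=> i; apply: pad_map_ind; first exact: feats_in_blank.
by move=> s; rewrite mem_filter => /andP[/hE[_ sV] _]; exact: IH.
Qed.

Lemma TDf_blank k : TDf p n zt k blank blank = 0.
Proof.
have p0 : 0 < p by exact: lt_le_trans ltr01 p1.
have -> : TDf p n zt k blank blank = pnorm_rV p (zt - zt) by case: k.
rewrite subrr /pnorm_rV big1 ?powR0//; first by rewrite invr_neq0// gt_eqF.
by move=> i _; rewrite mxE normr0 powR0// gt_eqF.
Qed.

Lemma pnorm_rV_le (x : 'rV[R]_d) (c : R) : 0 <= c -> (forall i, `|x ord0 i| <= c) ->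
  pnorm_rV p x <= d%:R `^ p^-1 * c.
Proof.
move=> c0 h; have p0 : 0 < p by exact: lt_le_trans ltr01 p1.
have -> : d%:R `^ p^-1 * c = (\sum_(i < d) c `^ p) `^ p^-1.
  rewrite sumr_const card_ord -[in RHS]mulr_natl powRM ?powR_ge0//.
  by rewrite -powRrM mulfV ?gt_eqF// powRr1.
apply: ge0_ler_powR.
- by rewrite invr_ge0 ltW.
- by rewrite nnegrE sumr_ge0// => i _; exact: powR_ge0.
- by rewrite nnegrE sumr_ge0// => i _; exact: powR_ge0.
- apply: ler_sum => i _; apply: ge0_ler_powR; rewrite ?nnegrE ?(ltW p0)//; exact: h.
Qed.

Lemma mx_le_pnorm m (x : nat -> R) : mx m x <= pnorm p m x.
Proof.
have p0 : 0 < p by exact: lt_le_trans ltr01 p1.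
apply: mx_le => [|i im]; first exact: powR_ge0.
rewrite -[leLHS]powRr1// -(mulfV (x := p)) ?gt_eqF// powRrM /pnorm.
apply: ge0_ler_powR.
- by rewrite invr_ge0 ltW.
- by rewrite nnegrE powR_ge0.
- by rewrite nnegrE sumr_ge0// => j _; exact: powR_ge0.
- rewrite (bigD1 (Ordinal im))//= lerDl; apply: sumr_ge0 => j _; exact: powR_ge0.
Qed.

(** * Sorted lists as matchings *)

Lemma sort_perm (f : 'I_n -> R) : exists s : 'S_n, forall j : 'I_n,
  nth 0 (sort <=%R [seq f i | i <- enum 'I_n]) j = f (s j).
Proof.
pose t := [tuple f i | i < n]; pose u := [tuple of sort <=%R t].
have : perm_eq u t by rewrite /= perm_sort.
move=> /tuple_permP[s hs]; exists s => j.
have -> : sort <=%R [seq f i | i <- enum 'I_n] = u by [].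
rewrite hs (nth_map j) ?size_enum_ord// nth_ord_enum.
by rewrite tnth_mktuple.
Qed.

(* A permutation realizing the two sorted lists induces a matching of the two
   multisets, for which every projected distance is almost the full distance. *)
Lemma Wdist_le_sort m (a : nat -> R) (y y' : 'I_n -> nat -> R) (t t' : 'I_n -> T)
  dist A B (e e1 : R) : 0 < e -> 0 < e1 ->
  (exists s : 'S_n, forall j : 'I_n, pd A j = t (s j)) ->
  (exists s : 'S_n, forall j : 'I_n, pd B j = t' (s j)) ->
  (forall s s', e1 * dist (t s) (t' s') <= mx m (fun i => y s i - y' s' i)) ->
  (forall s s', e * mx m (fun i => y s i - y' s' i)
                <= `|dot m a (fun i => y s i - y' s' i)|) ->
  e * e1 * Wdist n zt dist A B <= n%:R * mx n (fun j =>
     nth 0 (sort <=%R [seq dot m a (y s) | s <- enum 'I_n]) j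
     - nth 0 (sort <=%R [seq dot m a (y' s) | s <- enum 'I_n]) j).
Proof.
move=> e0 e10 [sA hA] [sB hB] h1 h2.
have [s1 hs1] := sort_perm (fun s => dot m a (y s)).
have [s2 hs2] := sort_perm (fun s => dot m a (y' s)).
(* From a position in [A] to its node, to the rank of that node, to the node of the same rank on the
   other side, to its position in [B]. *)
pose r := (sA * s1^-1 * s2 * sB^-1)%g.
set M := mx n _.
apply: (@le_trans _ _ (e * e1 * \sum_(j < n) dist (pd A j) (pd B (r j)))).
  by rewrite ler_wpM2l ?Wdist_le// mulr_ge0// ltW.
rewrite mulr_sumr; apply: (@le_trans _ _ (\sum_(j < n) M)); last first.
  by rewrite sumr_const card_ord mulr_natl.
apply: ler_sum => j _; rewrite hA hB /r !permM permKV.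
set i := (s1^-1)%g (sA j).
have -> : sA j = s1 i by rewrite /i permKV.
rewrite -mulrA; apply: le_trans (ler_wpM2l (ltW e0) (h1 _ _)) _.
apply: le_trans (h2 _ _) _.
have -> : dot m a (fun k => y (s1 i) k - y' (s2 i) k) = dot m a (y (s1 i)) - dot m a (y' (s2 i)).
  by rewrite /dot -sumrB; apply: eq_bigr => k _; rewrite mulrBr.
rewrite -hs1 -hs2.
exact: (mx_ge (fun j => nth 0 (sort <=%R [seq dot m a (y s) | s <- enum 'I_n]) j
  - nth 0 (sort <=%R [seq dot m a (y' s) | s <- enum 'I_n]) j) (ltn_ord i)).
Qed.

End Trees.

(** * Projections onto a direction *)

Section Algebra.
Variable R : realType.
Implicit Types (w x v : nat -> R).

(** A quarter turn in the first two coordinates, or the first basis vector if both vanish; this is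
    why the dimension is written [m.+2] below. *)
Definition perp w : nat -> R := fun i =>
  if i == 0%N then (if (w 0%N == 0) && (w 1%N == 0) then 1 else - w 1%N)
  else if i == 1%N then w 0%N else 0.

Lemma dot_perp m w : dot m.+2 w (perp w) = 0.
Proof.
rewrite /dot !big_ord_recl big1 => [|i _]; last by rewrite /perp /= mulr0.
rewrite /perp /= /bump /=; case: ifP => [/andP[/eqP -> /eqP ->]|_]; lra.
Qed.

Lemma perp_neq0 m w : 0 < sqnorm m.+2 (perp w).
Proof.
rewrite lt_neqAle sqnorm_ge0 andbT eq_sym.
apply/negP => /eqP s0.
have h i : (i < m.+2)%N -> perp w i = 0.
  move=> /(sqr_le_sqnorm (perp w)); rewrite s0 => hi.
  by apply/eqP; rewrite -sqrf_eq0 eq_le hi sqr_ge0.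
have := h 0%N erefl; have := h 1%N erefl; rewrite /perp /=.
by move=> ->; case: ifPn => [_ /eqP|]; rewrite ?oner_eq0// eqxx /= => /eqP h1 /eqP; rewrite oppr_eq0 => /eqP.
Qed.

Lemma dotC m w v : dot m w v = dot m v w.
Proof. by apply: eq_bigr => i _; rewrite mulrC. Qed.

Lemma sqnorm_comb m w x v (a b c : R) :
  sqnorm m (fun i => a * w i + b * x i + c * v i) =
  a ^+ 2 * sqnorm m w + b ^+ 2 * sqnorm m x + c ^+ 2 * sqnorm m v
  + 2 * (a * b * dot m w x + a * c * dot m w v + b * c * dot m x v).
Proof.
rewrite /sqnorm /dot !mulr_sumr -!big_split /= mulr_sumr -big_split /=.
by apply: eq_bigr => i _; ring.
Qed.

Lemma sqnorm_le_mx m v : sqnorm m v <= m%:R * mx m v ^+ 2.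
Proof.
rewrite /sqnorm; apply: (@le_trans _ _ (\sum_(i < m) mx m v ^+ 2)); last first.
  by rewrite sumr_const card_ord mulr_natl.
apply: ler_sum => i _; rewrite -real_normK ?num_real//.
by rewrite ler_sqr ?nnegrE ?mx_ge0// mx_ge.
Qed.

(* Bessel's inequality for the orthogonal pair [w], [perp w]: if the component of
   the unit vector [x] along [perp w] is not small, then [dot x w] cannot be as
   large as [z]. *)
Lemma dot_gap m x w (e z : R) : on_sphere m.+2 x -> 0 < e -> e <= 1 ->
  sqnorm m.+2 w < z ^+ 2 ->
  e * mx m.+2 (perp w) <= `|dot m.+2 x (perp w)| ->
  e ^+ 2 / (2 * m.+2%:R) * `|z| <= `|dot m.+2 x w - z|.
Proof.
move=> x1 e0 e1 wz hx; set M := m.+2 in x1 wz hx *.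
have M1 : 1 <= M%:R :> R by rewrite ler1n.
set v := perp w in hx *; have v0 : 0 < sqnorm M v by exact: perp_neq0.
have wv : dot M w v = 0 by exact: dot_perp.
set W := sqnorm M w in wz; set V := sqnorm M v in v0.
set D := dot M x w; set E := dot M x v.
have W0 : 0 <= W by exact: sqnorm_ge0.
have bes : D ^+ 2 * V + E ^+ 2 * W <= V * W.
  have [W00|Wn] := eqVneq W 0.
    have D0 : D = 0.
      rewrite /D /dot big1// => i _.
      have := sqr_le_sqnorm w (ltn_ord i); rewrite -/W W00 => h.
      have /eqP -> : w i == 0 by rewrite -sqrf_eq0 eq_le h sqr_ge0.
      by rewrite mulr0.
    by rewrite D0 W00; lra.
  have Wp : 0 < W by rewrite lt_neqAle eq_sym Wn.
  (* The inequality comes from expanding the squared norm of the residual of [x] after projection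
     onto [w] and [v]. *)
  have := sqnorm_ge0 M (fun i => 1 * x i + (- (D / W)) * w i + (- (E / V)) * v i).
  rewrite sqnorm_comb -/D -/E -/W -/V wv.
  have -> : sqnorm M x = 1 by exact: x1.
  set q := (X in 0 <= X -> _) => q0.
  have : 0 <= V * W * q by rewrite !mulr_ge0// ltW.
  have -> : V * W * q = V * W - D ^+ 2 * V - E ^+ 2 * W.
    by rewrite /q; field; rewrite !gt_eqF.
  lra.
have EV : e ^+ 2 * V <= M%:R * E ^+ 2.
  apply: (@le_trans _ _ (M%:R * (e * mx M v) ^+ 2)).
    by rewrite exprMn mulrCA ler_wpM2l ?sqr_ge0// sqnorm_le_mx.
  rewrite ler_wpM2l// -(real_normK (num_real E)).
  by rewrite ler_sqr ?nnegrE// mulr_ge0 ?mx_ge0// ltW.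
(* [k] is the relative loss: [|E|] being large leaves [D ^+ 2 <= (1 - 2 * k) * W], and
   [1 - 2 * k <= (1 - k) ^+ 2]. *)
pose k := e ^+ 2 / (2 * M%:R).
have k0 : 0 <= k by rewrite divr_ge0 ?sqr_ge0// mulr_ge0// ltW.
have kE : e ^+ 2 = 2 * k * M%:R by rewrite /k; field; rewrite gt_eqF//; lra.
have k1 : k <= 1.
  rewrite /k ler_pdivrMr; last lra.
  have : e ^+ 2 <= 1 by rewrite expr_le1// ltW.
  lra.
have DW : D ^+ 2 <= (1 - 2 * k) * W.
  have h1 : 2 * k * V <= E ^+ 2.
    rewrite -(@ler_pM2l _ M%:R); last lra.
    by apply: le_trans EV; rewrite kE; lra.
  rewrite -(ler_pM2r v0).
  have := ler_wpM2r W0 h1; lra.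
have Dz : D ^+ 2 <= ((1 - k) * `|z|) ^+ 2.
  rewrite exprMn real_normK ?num_real//.
  apply: le_trans DW _.
  apply: (@le_trans _ _ ((1 - k) ^+ 2 * W)).
    by rewrite ler_wpM2r//; have := sqr_ge0 k; lra.
  by rewrite ler_wpM2l ?sqr_ge0// ltW.
have Da : `|D| <= (1 - k) * `|z|.
  rewrite -ler_sqr ?nnegrE// ?real_normK ?num_real//.
  by rewrite mulr_ge0//; lra.
have := lerB_dist z D; rewrite (distrC z D) -/k; lra.
Qed.

(** The coefficient [z / W] along [w] fixes the product, and [z ^+ 2 <= W] leaves room to reach norm
    1 along [perp w]. If [W = 0] then [z = 0], and division by zero yielding 0 makes the same
    formula work. *)
Lemma exists_dot m w (z : R) : z ^+ 2 <= sqnorm m.+2 w ->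
  exists2 x, on_sphere m.+2 x & dot m.+2 x w = z.
Proof.
set M := m.+2; set W := sqnorm M w => zW.
set v := perp w; have v0 : 0 < sqnorm M v by exact: perp_neq0.
have wv : dot M w v = 0 by exact: dot_perp.
set V := sqnorm M v in v0.
have lin (a b c : R) : dot M (fun i => a * w i + b * v i + c * v i) w = a * W.
  have -> : dot M (fun i => a * w i + b * v i + c * v i) w =
    a * dot M w w + b * dot M v w + c * dot M v w.
    by rewrite /dot !mulr_sumr -!big_split /=; apply: eq_bigr => i _; ring.
  rewrite (dotC _ v) wv !mulr0 !addr0; congr (_ * _).
pose b := Num.sqrt ((1 - z ^+ 2 / W) / V).
have hb : b ^+ 2 * V = 1 - z ^+ 2 / W.
  rewrite /b sqr_sqrtr ?divfK ?gt_eqF//.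
  rewrite divr_ge0 ?(ltW v0)// subr_ge0.
  have [->|Wn] := eqVneq W 0; first by rewrite invr0 mulr0.
  by rewrite ler_pdivrMr ?mul1r// lt_neqAle eq_sym Wn sqnorm_ge0.
exists (fun i => z / W * w i + b * v i + 0 * v i).
  suff : sqnorm M (fun i => z / W * w i + b * v i + 0 * v i) = 1 by [].
  rewrite sqnorm_comb -/V -/W wv.
  have [W0|Wn] := eqVneq W 0; first by move: hb; rewrite W0 invr0; lra.
  by rewrite hb; field.
rewrite lin; have [W0|Wn] := eqVneq W 0; last by rewrite divfK.
rewrite W0 mulr0; apply/esym/eqP; rewrite -sqrf_eq0 eq_le sqr_ge0 andbT.
by rewrite -W0.
Qed.

End Algebra.

(** * Small-ball estimates for the network *)

#[local] Arguments par : simpl never.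

(** * Bounds from compactness and the layout of the parameter list *)

Section Params.
Variables (R : realType) (d n : nat).

Lemma emb_ord (x : 'rV[R]_d) (i : 'I_d) : emb x i = x ord0 i.
Proof. by rewrite /emb valK. Qed.

Lemma compact_rV_bounded (Omega : set 'rV[R]_d) : compact Omega ->
  exists2 B : R, 0 <= B & forall x, Omega x -> forall i, `|x ord0 i| <= B.
Proof.
move=> /compact_bounded[M [Mr hM]].
have M0 : 0 <= `|M| + 1 by rewrite addr_ge0.
exists (`|M| + 1) => // x Ox i.
have := hM (`|M| + 1) _ x Ox; rewrite ltr_pwDr ?ler_norm// => /(_ erefl) h.
apply: le_trans h; rewrite [leRHS]mx_normrE.
exact: (le_bigmax _ (fun ij => `|x ij.1 ij.2|) (ord0, i)).
Qed.

Lemma compact_rV_sep (Omega : set 'rV[R]_d) (z : 'rV[R]_d) : compact Omega -> ~ Omega z ->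
  exists2 e : R, 0 < e & forall x, Omega x -> e <= mx d (fun i => emb x i - emb z i).
Proof.
move=> cO Oz.
have : open (~` Omega)%classic by rewrite openC; apply: compact_closed cO; exact: norm_hausdorff.
rewrite openE => /(_ z Oz)/nbhs_ballP[e /= e0 he].
exists e => // x Ox; rewrite leNgt; apply/negP => h.
apply: (he x) => //; split => // i j; rewrite ord1 /ball /= distrC.
by apply: le_lt_trans h; rewrite -!emb_ord (mx_ge (fun i => emb x i - emb z i)).
Qed.

Lemma size_pdims K : size (pdims d n K) = (2 * K.+1)%N.
Proof.
rewrite /pdims size_cat size_flatten /shape -map_comp (eq_map (g := fun=> 2%N))//.
rewrite sumnE big_map big_const_seq count_predT size_iota iter_addn_0 /=; lia.
Qed.

Lemma nth_flatten_pairs (f g : nat -> nat) t a m k :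
  nth 0%N (flatten [seq [:: f i; g i] | i <- iota a m] ++ t) (2 * k) =
    (if (k < m)%N then f (a + k)%N else nth 0%N t (2 * (k - m))) /\
  nth 0%N (flatten [seq [:: f i; g i] | i <- iota a m] ++ t) (2 * k).+1 =
    (if (k < m)%N then g (a + k)%N else nth 0%N t (2 * (k - m)).+1).
Proof.
rewrite !mul2n; elim: m a k => [|m IH] a [|k]; rewrite ?subn0 ?addn0//=.
by rewrite ltnS subSS addnS -addSn; exact: IH.
Qed.

Lemma nth_pdims_even K k : (k <= K)%N -> nth 0%N (pdims d n K) (2 * k) = dimx d k.
Proof.
move=> kK; rewrite (nth_flatten_pairs _ _ _ _ _ _).1 add0n.
case: ltnP => // Kk; have -> : k = K by lia.
by rewrite subnn.
Qed.

Lemma nth_pdims_odd K k : (k < K)%N -> nth 0%N (pdims d n K) (2 * k).+1 = (dimx d k + n)%N.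
Proof. by move=> kK; rewrite (nth_flatten_pairs _ _ _ _ _ _).2 add0n kK. Qed.

Lemma nth_pdims_last K : nth 0%N (pdims d n K) (2 * K).+1 = n.
Proof. by rewrite (nth_flatten_pairs _ _ _ _ _ _).2 ltnn subnn. Qed.

Lemma pdims_gt0 K i : (0 < d)%N -> (0 < n)%N -> (i < size (pdims d n K))%N ->
  (0 < nth 0%N (pdims d n K) i)%N.
Proof.
move=> d0 n0; rewrite size_pdims => iK.
have dx k : (0 < dimx d k)%N by case: k.
have := odd_double_half i; set k := i./2; rewrite -mul2n.
case: (odd i) => /= <-; rewrite ?add0n ?add1n.
  have kK : (k <= K)%N by rewrite /k; lia.
  move: kK; rewrite leq_eqVlt => /predU1P[->|kK]; first by rewrite nth_pdims_last.
  by rewrite nth_pdims_odd// addn_gt0 dx.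
rewrite nth_pdims_even//; rewrite /k; lia.
Qed.

(** Independence enters here: a layer ignores all later parameters, which can then be integrated
    with its features held fixed. *)
Lemma eq_layer (G : graph R d n) z k (ws ws' : seq (nat -> R)) :
  (forall j, (j < 2 * k)%N -> par ws j = par ws' j) ->
  layer G ws z k = layer G ws' z k.
Proof.
elim: k => [//|k IH] h /=.
rewrite IH => [|j jk]; last by apply: h; lia.
by rewrite !h//; lia.
Qed.

Lemma par_take (ws : seq (nat -> R)) i j : (j < i)%N -> par (take i ws) j = par ws j.
Proof. by move=> ji; rewrite /par nth_take. Qed.

Lemma layer_take (G : graph R d n) z k i (ws : seq (nat -> R)) : (2 * k <= i)%N ->
  layer G (take i ws) z k = layer G ws z k.
Proof. by move=> ki; apply: eq_layer => j jk; rewrite par_take//; lia. Qed.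

End Params.

Section SmallBall.
Variables (R : realType) (p : R) (n d K : nat).
Variables (Omega : set 'rV[R]_d) (zt z0 : 'rV[R]_d) (zs : nat -> R).
Hypotheses (p1 : 1 <= p) (n0 : (0 < n)%N) (d0 : (0 < d)%N) (cO : compact Omega).
Hypothesis Oz0 : ~ Omega z0.
Hypothesis Okz : forall k, (1 <= k <= K)%N ->
  ~ Omega_k n Omega (zfam z0 zs) K k (zs k).
Notation z := (zfam z0 zs).
Notation ms := (pdims d n K).
Notation layer := (fun G ws k => layer G ws z k).
Notation TDf := (TDf p n zt).
Notation Wdist := (Wdist n zt).
Implicit Types (G H : graph R d n) (ws : seq (nat -> R)) (k : nat).

(* Both properties are small-ball estimates, uniform in the graphs: unlike lower
   bounds on expectations, they pass through the minimum over matchings. *)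
Definition separated k := forall eta : R, 0 < eta -> exists2 e : R, 0 < e &
  forall G H v u, valid_graph Omega G -> valid_graph Omega H ->
  pr ms (fun ws => [/\ v \in gV G, u \in gV H &
     mx (dimx d k) (fun i => layer G ws k v i - layer H ws k u i)
     < e * TDf k (comp_tree G k v) (comp_tree H k u)]) eta.

Definition off_blank k := forall eta : R, 0 < eta -> exists2 e : R, 0 < e &
  forall G v, valid_graph Omega G ->
  pr ms (fun ws => v \in gV G /\
     mx (dimx d k) (fun i => layer G ws k v i - z k i) < e) eta.

(** With [P] a neighbourhood this is the input of a layer, with [P] the node set that of the
    readout. *)
Definition padded (P : pred 'I_n) G ws k (s : 'I_n) : nat -> R :=
  if P s then layer G ws k s else z k.

Definition sorted_proj (P : pred 'I_n) G ws k : seq R :=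
  sort <=%R [seq dot (dimx d k) (par ws (2 * k)) (padded P G ws k s) | s <- enum 'I_n].

Lemma TDf_le k : exists2 D : R, 0 <= D & forall G H, valid_graph Omega G -> valid_graph Omega H ->
  forall v u, (v \in gV G -> TDf k (comp_tree G k v) (blank_tree zt) <= D) /\
              (u \in gV H -> TDf k (blank_tree zt) (comp_tree H k u) <= D).
Proof.
have [B B0 hB] := compact_rV_bounded cO.
pose P x := Omega x \/ x = zt.
pose N := d%:R `^ p^-1 * (2 * (B + mx d (emb zt))).
have Z0 : 0 <= mx d (emb zt) by exact: mx_ge0.
have N0 : 0 <= N by rewrite mulr_ge0 ?powR_ge0//; lra.
have hP x i : P x -> `|x ord0 i| <= B + mx d (emb zt).
  case=> [Ox|->]; first by apply: le_trans (hB _ Ox i) _; rewrite lerDl.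
  apply: (@le_trans _ _ (mx d (emb zt))); last by rewrite lerDr.
  by rewrite -emb_ord; exact: mx_ge.
have hN x y : P x -> P y -> pnorm_rV p (x - y) <= N.
  move=> Px Py; apply: pnorm_rV_le => //; first by lra.
  move=> i; rewrite !mxE; apply: le_trans (ler_normB _ _) _.
  have := hP x i Px; have := hP y i Py; lra.
have [D D0 hD] := TDf_bounded n zt k N0 hN.
have Pzt : P zt by right.
exists D => // G H vG vH v u; have OP x : Omega x -> P x by left.
by split=> [vV|uV]; apply: hD;
  first [exact: feats_in_blank | exact: feats_in_comp_tree vG OP Pzt vV
        | exact: feats_in_comp_tree vH OP Pzt uV].
Qed.

Lemma separated0 : separated 0.
Proof.
move=> eta eta0; pose C : R := d%:R `^ p^-1 + 1.
have C0 : 0 < C by rewrite ltr_wpDl// powR_ge0.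
exists C^-1 => [|G H v u vG vH]; first by rewrite invr_gt0.
apply: pr_false => [ws _ [_ _]|]; last exact: ltW.
apply/negP; rewrite -leNgt ler_pdivrMl//=; set M := mx _ _.
have M0 : 0 <= M by exact: mx_ge0.
apply: (@le_trans _ _ (d%:R `^ p^-1 * M)); last by rewrite ler_wpM2r// /C lerDl.
apply: pnorm_rV_le => // i; rewrite !mxE -!emb_ord.
exact: (mx_ge (fun i => emb (gX G v) i - emb (gX H u) i) (ltn_ord i)).
Qed.

Lemma off_blank0 : off_blank 0.
Proof.
move=> eta eta0; have [e e0 he] := compact_rV_sep cO Oz0.
exists e => // G v [_ _ _ hX].
apply: pr_false => [ws _ [vV]|]; last exact: ltW.
by apply/negP; rewrite -leNgt; apply: he; exact: hX.
Qed.

(** For each pair of indices four events are excluded: two nodes too close, a node of either graph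
    too close to the blank value, and a direction nearly orthogonal to the difference of the padded
    features. Off their union [Wdist_le_sort] applies. *)
Lemma sorted_proj_sep k : (k <= K)%N -> separated k -> off_blank k ->
  forall eta : R, 0 < eta -> exists2 e : R, 0 < e &
  forall G H (P Q : pred 'I_n), valid_graph Omega G -> valid_graph Omega H ->
  {subset P <= gV G} -> {subset Q <= gV H} ->
  pr ms (fun ws => n%:R * mx n (fun j => nth 0 (sorted_proj P G ws k) j
                                  - nth 0 (sorted_proj Q H ws k) j)
     < e * Wdist (TDf k) [seq comp_tree G k s | s <- enum 'I_n & P s]
                         [seq comp_tree H k s | s <- enum 'I_n & Q s]) eta.
Proof.
move=> kK hS hB eta eta0.
pose N : R := #|{: 'I_n * 'I_n}|%:R.
have N0 : 0 < N by rewrite ltr0n card_prod card_ord muln_gt0 n0.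
pose h := eta / (4 * N).
have h0 : 0 < h by rewrite divr_gt0// mulr_gt0.
have [eS eS0 {}hS] := hS h h0.
have [eB eB0 {}hB] := hB h h0.
have i1 : (2 * k < size ms)%N by rewrite size_pdims; lia.
have [eL eL0 hL] := pr_nth_slab i1 h0.
rewrite nth_pdims_even// in hL.
have [D D0 hD] := TDf_le k.
(* Two nodes need [eS]; a node and a blank have distance at most [D] and features at least [eB]
   apart. [D + 1] is used because [D] may be 0. *)
pose e1 := Num.min eS (eB / (D + 1)).
have e10 : 0 < e1 by rewrite lt_min eS0 divr_gt0// ltr_wpDl.
have e1S : e1 <= eS by rewrite ge_min lexx.
have e1B : e1 * D <= eB.
  apply: (@le_trans _ _ (eB / (D + 1) * D)).
    by rewrite ler_wpM2r// ge_min lexx orbT.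
  by rewrite -mulrA ler_piMr ?(ltW eB0)// ler_pdivrMl; lra.
exists (eL * e1) => [|G H P Q vG vH PV QV]; first exact: mulr_gt0.
pose diff ws s s' := fun i => padded P G ws k s i - padded Q H ws k s' i.
pose bad (s : 'I_n * 'I_n) ws :=
  ([/\ s.1 \in gV G, s.2 \in gV H &
     mx (dimx d k) (fun i => layer G ws k s.1 i - layer H ws k s.2 i)
     < eS * TDf k (comp_tree G k s.1) (comp_tree H k s.2)] \/
   (s.1 \in gV G /\ mx (dimx d k) (fun i => layer G ws k s.1 i - z k i) < eB)) \/
  ((s.2 \in gV H /\ mx (dimx d k) (fun i => layer H ws k s.2 i - z k i) < eB) \/
   `|dot (dimx d k) (par ws (2 * k)) (diff (take (2 * k) ws) s.1 s.2)| <
       eL * mx (dimx d k) (diff (take (2 * k) ws) s.1 s.2)).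
have prbad : pr ms (fun ws => exists s, bad s ws) eta.
  have -> : eta = N * ((h + h) + (h + h)) by rewrite /h; field; rewrite gt_eqF.
  apply: pr_exists; first by lra.
  move=> s; apply: pr_or; apply: pr_or; [exact: hS|exact: hB|exact: hB|].
  exact: (hL (fun ws => diff ws s.1 s.2)).
apply: pr_le prbad => // ws sws; apply: contraPP => nbad.
apply/negP; rewrite -leNgt.
pose t s := if P s then comp_tree G k s else blank_tree zt.
pose t' s := if Q s then comp_tree H k s else blank_tree zt.
apply: (@Wdist_le_sort _ _ _ _ _ _ _ _ t t') => //.
- exact: pad_perm.
- exact: pad_perm.
- move=> s s'; have /not_orP[/not_orP[b1 b2] /not_orP[b3 _]] : ~ bad (s, s') ws.
    by move=> b; apply: nbad; exists (s, s').
  have [hDG hDH] := hD G H vG vH s s'.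
  rewrite /t /t' /padded; case: ifPn => Ps; case: ifPn => Qs.
  + rewrite leNgt; apply/negP => h1; apply: b1; split; [exact: PV|exact: QV|].
    by apply: lt_le_trans h1 _; rewrite ler_wpM2r// TDf_ge0.
  + have /hDG h1 := PV _ Ps.
    apply: (@le_trans _ _ (e1 * D)); first by rewrite ler_wpM2l// ltW.
    apply: le_trans e1B _; rewrite leNgt; apply/negP => h2; apply: b2; split => //.
    exact: PV.
  + have /hDH h1 := QV _ Qs.
    apply: (@le_trans _ _ (e1 * D)); first by rewrite ler_wpM2l// ltW.
    apply: le_trans e1B _; rewrite leNgt; apply/negP => h2; apply: b3; split.
      exact: QV.
    by apply: le_lt_trans h2; rewrite /mx; under eq_bigr do rewrite distrC.
  + by rewrite TDf_blank// mulr0 mx_ge0.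
- move=> s s'; rewrite leNgt; apply/negP => h1; apply: nbad; exists (s, s').
  right; right; rewrite /diff /=.
  have ht (F : graph R d n) P' s'' : padded P' F (take (2 * k) ws) k s'' = padded P' F ws k s''.
    by rewrite /padded layer_take.
  by rewrite !ht.
Qed.

Lemma mx1 (a b : R) : mx 1 (fun i => scal a i - scal b i) = `|a - b|.
Proof.
apply/eqP; rewrite eq_le; apply/andP; split.
  by apply: mx_le => [|[|i]].
exact: (mx_ge (fun i => scal a i - scal b i) (ltnSn 0)).
Qed.

(** The vector multiplied by [d^(k+1)]; it depends only on the first [2 * k + 1] parameters. *)
Definition hidden G ws k (v : 'I_n) : nat -> R :=
  concat (dimx d k) (layer G ws k v) (sorted_proj (gE G v) G ws k).

Lemma layerS G ws k v : layer G ws k.+1 v =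
  scal (dot (dimx d k + n) (par ws (2 * k).+1) (hidden G ws k v)).
Proof. by []. Qed.

Lemma eq_hidden G k ws ws' v : (forall j, (j < (2 * k).+1)%N -> par ws j = par ws' j) ->
  hidden G ws k v = hidden G ws' k v.
Proof.
move=> h; rewrite /hidden /sorted_proj /padded.
rewrite (eq_layer G z (k := k) (ws := ws) (ws' := ws')) ?h//.
by move=> j jk; apply: h; lia.
Qed.

Lemma hidden_take G k ws v : hidden G (take (2 * k).+1 ws) k v = hidden G ws k v.
Proof. by apply: eq_hidden => j jk; rewrite par_take. Qed.

Lemma dotB m (a x y : nat -> R) : dot m a x - dot m a y = dot m a (fun i => x i - y i).
Proof. by rewrite /dot -sumrB; apply: eq_bigr => i _; rewrite mulrBr. Qed.

(** The hidden vectors keep both parts of [TDf k.+1]: the old features control the root term and the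
    sorted projections the Wasserstein term. A fresh direction then preserves their difference up to
    a factor. *)
Lemma separatedS k : (k < K)%N -> separated k -> off_blank k -> separated k.+1.
Proof.
move=> kK hS hB eta eta0; have h0 : 0 < eta / 3 by lra.
have [eM eM0 hM] := sorted_proj_sep (ltnW kK) hS hB h0.
have [e0 e00 {}hS] := hS _ h0.
have i1 : ((2 * k).+1 < size ms)%N by rewrite size_pdims; lia.
have [eL eL0 hL] := pr_nth_slab i1 h0.
rewrite nth_pdims_odd// in hL.
have n00 : 0 < n%:R :> R by rewrite ltr0n.
pose c := e0^-1 + n%:R / eM.
have c0 : 0 < c by rewrite addr_gt0 ?invr_gt0 ?divr_gt0.
exists (eL / c) => [|G H v u vG vH]; first exact: divr_gt0.
have [hEG _ _ _] := vG; have [hEH _ _ _] := vH.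
have PV : {subset gE G v <= gV G} by move=> s /hEG[].
have QV : {subset gE H u <= gV H} by move=> s /hEH[].
pose diff ws := fun i => hidden G ws k v i - hidden H ws k u i.
have := pr_or (pr_or (hM G H _ _ vG vH PV QV) (hS G H v u vG vH)) (hL diff).
apply: pr_le; last lra.
move=> ws sws; apply: contraPP => /not_orP[/not_orP[b1 b2] b3] [vV uV].
apply/negP; rewrite -leNgt !layerS mx1 dotB.
have -> : (fun i => hidden G ws k v i - hidden H ws k u i) = diff (take (2 * k).+1 ws).
  by rewrite /diff !hidden_take.
move/negP: b3; rewrite -leNgt; apply: le_trans.
rewrite -mulrA ler_wpM2l ?(ltW eL0)// mulrC ler_pdivrMr//.
set M := mx _ _.
have Md : mx (dimx d k) (fun i => layer G ws k v i - layer H ws k u i) <= M.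
  apply: mx_le => [|i ik]; first exact: mx_ge0.
  have ik' : (i < dimx d k + n)%N by rewrite (leq_trans ik)// leq_addr.
  apply: le_trans (mx_ge (diff (take (2 * k).+1 ws)) ik').
  by rewrite /diff !hidden_take /hidden /concat ik.
have Mc : mx n (fun j => nth 0 (sorted_proj (gE G v) G ws k) j
                          - nth 0 (sorted_proj (gE H u) H ws k) j) <= M.
  apply: mx_le => [|j jn]; first exact: mx_ge0.
  have jn' : (dimx d k + j < dimx d k + n)%N by rewrite ltn_add2l.
  apply: le_trans (mx_ge (diff (take (2 * k).+1 ws)) jn').
  by rewrite /diff !hidden_take /hidden /concat ltnNge leq_addr /= addKn.
move/negP: b1; rewrite -leNgt => b1.
have {b2} b2 : e0 * TDf k (comp_tree G k v) (comp_tree H k u) <= M.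
  apply: le_trans Md; rewrite leNgt; apply/negP => h; exact: b2.
set A := [seq comp_tree G k s | s <- enum 'I_n & gE G v s] in b1.
set B := [seq comp_tree H k s | s <- enum 'I_n & gE H u s] in b1.
set nr := pnorm_rV p (gX G v - gX H u).
have rG F x : root_feat (comp_tree F k x : tree 'rV[R]_d) = gX F x by case: (k).
(* The trees of levels [k] and [k.+1] at a node have the same root feature, and the root term is
   part of [TDf k]. *)
have h1 : e0 * nr <= M.
  apply: le_trans b2; rewrite ler_wpM2l ?(ltW e00)//.
  by have := root_le_TDf p n zt k (comp_tree G k v) (comp_tree H k u); rewrite !rG.
have h2 : eM * Wdist (TDf k) A B <= n%:R * M.
  by apply: le_trans b1 _; rewrite ler_wpM2l// ltW.
apply: (@le_trans _ _ (nr + Wdist (TDf k) A B)).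
  rewrite /= -/A -/B -/nr; case: ifP => // _.
  by rewrite lerDl Wdist_ge0// => *; exact: TDf_ge0.
rewrite /c mulrDr; apply: lerD.
  by rewrite ler_pdivlMr// mulrC.
by rewrite mulrA ler_pdivlMr// mulrC (mulrC M).
Qed.

(* Otherwise some [d^(k+1)] on the sphere would make the new feature equal to
   the excluded value. *)
Lemma hidden_lt G ws k v : (k < K)%N -> valid_graph Omega G -> v \in gV G ->
  valid_params d n K ws ->
  sqnorm (dimx d k + n) (hidden G ws k v) < zs k.+1 ^+ 2.
Proof.
move=> kK vG vV [sws hws]; rewrite ltNge; apply/negP => hz.
have [m Em] : exists m, (dimx d k + n = m.+2)%N.
  have : (0 < dimx d k)%N by case: (k).
  by case: (dimx d k) => // -[|a] _; case: n n0 => // b _; eexists; rewrite ?addSn ?addnS.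
have [x x1 xz] : exists2 x, on_sphere (dimx d k + n) x &
    dot (dimx d k + n) x (hidden G ws k v) = zs k.+1.
  by rewrite Em in hz *; exact: exists_dot.
apply: (Okz (k := k.+1)) => //.
(* Only [d^(k+1)] is replaced, so the hidden vector does not change. *)
pose ws' := set_nth (fun=> 0) ws (2 * k).+1 x.
have i1 : ((2 * k).+1 < size ws)%N by rewrite sws size_pdims; lia.
have sws' : size ws' = size ws by rewrite /ws' size_set_nth; apply/maxn_idPr.
exists G; split => //; exists v; split => //; exists ws'; split.
  split; first by rewrite sws'.
  move=> i; rewrite sws' => iw; rewrite /ws' nth_set_nth /=.
  case: eqP => [->|_]; last exact: hws.
  by rewrite nth_pdims_odd.
rewrite layerS /scal /= -xz; congr dot.
  by rewrite /par /ws' nth_set_nth /= eqxx.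
by apply: eq_hidden => j jk; rewrite /par /ws' nth_set_nth /= (ltn_eqF jk).
Qed.

(** Non-attainability concerns parameters on the spheres, so lists leaving a sphere join the bad
    event. On the rest [hidden_lt] and [dot_gap] give the gap. *)
Lemma off_blankS k : (k < K)%N -> off_blank k.+1.
Proof.
move=> kK eta eta0.
pose N : R := #|{: 'I_(size ms)}|%:R.
have N0 : 0 < N by rewrite ltr0n card_ord size_pdims.
have h0 : 0 < eta / (2 * N) by rewrite divr_gt0// mulr_gt0.
have h1 : 0 < eta / 2 by lra.
have i1 : ((2 * k).+1 < size ms)%N by rewrite size_pdims; lia.
have [eL eL0 hL] := pr_nth_slab i1 h1.
rewrite nth_pdims_odd// in hL.
have [m Em] : exists m, (dimx d k + n = m.+2)%N.
  have : (0 < dimx d k)%N by case: (k).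
  by case: (dimx d k) => // -[|a] _; case: n n0 => // b _; eexists; rewrite ?addSn ?addnS.
pose e := Num.min eL 1.
have e0 : 0 < e by rewrite lt_min eL0 ltr01.
have e1 : e <= 1 by rewrite ge_min lexx orbT.
have eeL : e <= eL by rewrite ge_min lexx.
pose c := e ^+ 2 / (2 * m.+2%:R).
have c0 : 0 < c by rewrite divr_gt0 ?exprn_gt0// mulr_gt0.
pose zk := zs k.+1.
(* If [zk = 0] the strict inequality of [hidden_lt] is contradictory, so any positive value would
   do. *)
exists (if zk == 0 then 1 else c * `|zk|).
  by case: eqP => // /eqP z0'; rewrite mulr_gt0// normr_gt0.
move=> G v vG.
have prS : pr ms (fun ws => exists i : 'I_(size ms), ~ on_sphere (nth 0%N ms i) (par ws i))
   (N * (eta / (2 * N))).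
  apply: pr_exists => [|i]; first exact: ltW.
  by apply: pr_not_sphere => //; exact: pdims_gt0.
have := pr_or prS (hL (fun ws => perp (hidden G ws k v))).
apply: pr_le; last first.
  have -> : N * (eta / (2 * N)) = eta / 2 by field; rewrite gt_eqF.
  lra.
move=> ws sws; apply: contraPP => /not_orP[b1 b2] [vV].
have vw : valid_params d n K ws.
  split => // i; rewrite sws => im; apply: contrapT => ni.
  by apply: b1; exists (Ordinal im).
have hz := hidden_lt kK vG vV vw; rewrite -/zk in hz.
have zk0 : zk != 0.
  apply/eqP => zk0; move: hz; rewrite zk0 expr0n /=.
  by apply/negP; rewrite -leNgt sqnorm_ge0.
rewrite (negbTE zk0); apply/negP; rewrite -leNgt.
rewrite layerS [z _]/= mx1 -/zk.
move/negP: b2; rewrite -leNgt hidden_take Em => b2.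
rewrite Em in hz; apply: dot_gap => //.
  have := vw.2 (2 * k).+1; rewrite sws nth_pdims_odd// Em; exact.
by apply: le_trans b2; rewrite ler_wpM2r// mx_ge0.
Qed.

Lemma separated_all k : (k <= K)%N -> separated k /\ off_blank k.
Proof.
elim: k => [|k IH] kK; first by split; [exact: separated0|exact: off_blank0].
have [hS hB] := IH (ltnW kK).
by split; [exact: separatedS|exact: off_blankS].
Qed.

(** * The two lower bounds on expectations *)

Lemma node_bound k : (k <= K)%N -> exists2 c : R, 0 < c &
  forall G H v u, valid_graph Omega G -> valid_graph Omega H ->
  v \in gV G -> u \in gV H ->
  ((c * powR (TD p n zt (comp_tree G k v) (comp_tree H k u)) p)%:E
   <= Eseq ms (fun ws => (powR (pnorm p (dimx d k)
        (fun i => layer G ws k v i - layer H ws k u i)) p)%:E))%E.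
Proof.
move=> kK; have [k0 k00 hE] := @Eseq_ge_of_pr R ms.
have k2 : 0 < k0 / 2 by lra.
have [hS _] := separated_all kK; have [e e0 {}hS] := hS _ k2.
exists (k0 / 2 * e `^ p); first by rewrite mulr_gt0// powR_gt0.
move=> G H v u vG vH vV uV; 
rewrite (TDE p n zt (depth_comp_tree G k v) (depth_comp_tree H k u)).
set D := TDf k _ _; have D0 : 0 <= D by exact: TDf_ge0.
rewrite -mulrA -powRM ?(ltW e0)//.
apply: hE (hS G H v u vG vH); first exact: powR_ge0.
- by move=> ws; rewrite lee_fin powR_ge0.
- move=> ws _ nb; rewrite lee_fin; apply: ge0_ler_powR.
  + by apply: le_trans p1.
  + by rewrite nnegrE mulr_ge0// ltW.
  + by rewrite nnegrE powR_ge0.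
  + apply: le_trans (mx_le_pnorm p1 _ _); rewrite leNgt; apply/negP => h; exact: nb.
Qed.

(** The readout acts like one more layer without the concatenation, with the node sets in place of
    the neighbourhoods. *)
Lemma readout_bound : exists2 c : R, 0 < c &
  forall G H, valid_graph Omega G -> valid_graph Omega H ->
  ((c * powR (TMD p zt K G H) p)%:E
   <= Eseq ms (fun ws => (powR `|readout G ws z K - readout H ws z K| p)%:E))%E.
Proof.
have [k0 k00 hE] := @Eseq_ge_of_pr R ms.
(* The mass [k0 / 2] allowed by [Eseq_ge_of_pr] is divided between the sorting event and the last
   direction [b]. *)
have k4 : 0 < k0 / 2 / 2 by lra.
have [hS hB] := separated_all (leqnn K).
have [eM eM0 hM] := sorted_proj_sep (leqnn K) hS hB k4.
have i1 : ((2 * K).+1 < size ms)%N by rewrite size_pdims; lia.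
have [eL eL0 hL] := pr_nth_slab i1 k4; rewrite nth_pdims_last in hL.
have n00 : 0 < n%:R :> R by rewrite ltr0n.
pose e := eL * eM / n%:R.
have e0 : 0 < e by rewrite divr_gt0// mulr_gt0.
exists (k0 / 2 * e `^ p); first by rewrite mulr_gt0 ?powR_gt0//; lra.
move=> G H vG vH; rewrite TMDE.
have enumV (F : graph R d n) : enum (gV F) = [seq s <- enum 'I_n | s \in gV F].
  by rewrite [in LHS]/enum_mem -enumT.
rewrite !enumV.
set D := Wdist _ _ _.
have D0 : 0 <= D by apply: Wdist_ge0 => *; exact: TDf_ge0.
pose P (F : graph R d n) : pred 'I_n := fun s => s \in gV F.
pose diff ws := fun j => nth 0 (sorted_proj (P G) G ws K) j - nth 0 (sorted_proj (P H) H ws K) j.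
have dt ws : diff (take (2 * K).+1 ws) = diff ws.
  by rewrite /diff /sorted_proj /padded par_take// !layer_take.
rewrite -mulrA -powRM ?(ltW e0)//.
have hbad := pr_or (hM G H (P G) (P H) vG vH (fun _ => id) (fun _ => id)) (hL diff).
rewrite -splitr in hbad.
apply: hE hbad; first exact: powR_ge0.
- by move=> ws; rewrite lee_fin powR_ge0.
- move=> ws _ /not_orP[/negP b1 /negP b2]; rewrite -leNgt in b1; rewrite -leNgt dt in b2.
  rewrite lee_fin; apply: ge0_ler_powR.
  + by apply: le_trans p1.
  + by rewrite nnegrE mulr_ge0// ltW.
  + by rewrite nnegrE.
  + have -> : readout G ws z K - readout H ws z K = dot n (par ws (2 * K).+1) (diff ws).
      by rewrite -dotB.
    apply: le_trans b2; rewrite /e -!mulrA ler_wpM2l ?(ltW eL0)//.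
    by rewrite mulrCA ler_pdivrMl.
Qed.

End SmallBall.

(** Only finitely many depths occur, so the smallest constant serves for all. *)
Lemma uniform_lower_bound (R : realType) (K : nat) (Q : nat -> R -> Prop) :
  (forall k c c', c' <= c -> Q k c -> Q k c') ->
  (forall k, (k <= K)%N -> exists2 c : R, 0 < c & Q k c) ->
  exists2 c : R, 0 < c & forall k, (k <= K)%N -> Q k c.
Proof.
move=> hQ; elim: K => [|K IH] h.
  by have [c c0 hc] := h 0%N (leqnn _); exists c => // k; rewrite leqn0 => /eqP ->.
have [c c0 hc] := IH (fun k kK => h k (leqW kK)).
have [c' c'0 hc'] := h K.+1 (leqnn _).
exists (Num.min c c') => [|k]; first by rewrite lt_min c0.
rewrite leq_eqVlt => /predU1P[->|kK]; [apply: hQ hc'|apply: hQ (hc _ kK)].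
  by rewrite ge_min lexx orbT.
by rewrite ge_min lexx.
Qed.

Unset Implicit Arguments.

Theorem mainTheorem13 (R : realType) (p : R) (n d K : nat)
  (Omega : set 'rV[R]_d) (zt z0 : 'rV[R]_d) (zs : nat -> R) :
  1 <= p -> (0 < n)%N -> (0 < d)%N ->
  compact Omega ->
  ~ Omega zt ->
  ~ Omega z0 ->
  (forall k, (1 <= k <= K)%N ->
     ~ Omega_k n Omega (zfam z0 zs) K k (zs k)) ->
  exists c1 c2 : R, 0 < c1 /\ 0 < c2 /\
  (forall k, (k <= K)%N ->
   forall (G H : graph R d n) (v u : 'I_n),
     valid_graph Omega G -> valid_graph Omega H ->
     v \in gV G -> u \in gV H ->
     ((c1 * powR (TD p n zt (comp_tree G k v) (comp_tree H k u)) p)%:E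
      <= Eseq (pdims d n K) (fun ws =>
           (powR (pnorm p (dimx d k)
              (fun i => layer G ws (zfam z0 zs) k v i
                      - layer H ws (zfam z0 zs) k u i)) p)%:E))%E) /\
  (forall (G H : graph R d n),
     valid_graph Omega G -> valid_graph Omega H ->
     ((c2 * powR (TMD p zt K G H) p)%:E
      <= Eseq (pdims d n K) (fun ws =>
           (powR `|readout G ws (zfam z0 zs) K - readout H ws (zfam z0 zs) K| p)%:E))%E).
Proof.
move=> p1 n0 d0 cO _ Oz0 Okz.
have [c2 c20 h2] := readout_bound zt p1 n0 d0 cO Oz0 Okz.
have [|k kK|c1 c10 h1] := @uniform_lower_bound R K (fun k c =>
   forall (G H : graph R d n) (v u : 'I_n),
     valid_graph Omega G -> valid_graph Omega H ->
     v \in gV G -> u \in gV H ->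
     ((c * powR (TD p n zt (comp_tree G k v) (comp_tree H k u)) p)%:E
      <= Eseq (pdims d n K) (fun ws =>
           (powR (pnorm p (dimx d k)
              (fun i => layer G ws (zfam z0 zs) k v i
                      - layer H ws (zfam z0 zs) k u i)) p)%:E))%E).
- move=> k c c' cc h G H v u vG vH vV uV.
  by apply: le_trans (h G H v u vG vH vV uV); rewrite lee_fin ler_wpM2r// powR_ge0.
- exact: node_bound.
- by exists c1, c2.
Qed.
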